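(* Let $r>1$ and $e>1$ be integers, let $1\leq p<e$, and let $s=(s_0,s_1,\dots,s_e)$ be the vector with $s_e=1$, $1\leq s_p\leq r-1$, and $s_i=0$ for all $i\notin\{p,e\}$. Assume that $r\geq \text{min.emb.dim.}(s)$. Then: 1) There exists a generalized compressed algebra for the pair $(r,s)$. 2) Let $H=(1,h_1,\dots,h_e)$ (with $h_0=1$) be the $h$-vector of this generalized compressed algebra. Then: (a) If $p\geq \frac{e}{2}$, then $$h_i=\min\{N(r,i)-r_i,\; N(r,i)\}\quad\text{for } i=0,1,\dots,e.$$ (b) If $p<\frac{e}{2}$, then $H$ is given by $$h_i=N(r,i)\quad\text{for } i=0,\dots,p,$$ $$h_{p+a}=\big((N(r,p)-s_p)_{(p)}\big)_a^a\quad\text{for } a=1,\dots,\lfloor \tfrac e2\rfloor-p,$$ $$h_i=h_{e-i}\quad\text{for } i>\lfloor \tfrac e2\rfloor,\ i\neq e-p,$$ $$h_{e-p}=h_p-s_p=N(r,p)-s_p.$$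
   Context: Fix a field $k$ of characteristic zero. An algebra means a standard graded artinian algebra $A=R/I=\bigoplus_{i=0}^e A_i$, where $R=k[x_1,\dots,x_r]$ with all $x_i$ of degree $1$, $I$ is a homogeneous ideal containing no non-zero forms of degree $1$, and $e$ is the last index with $A_e\neq 0$. The embedding dimension of $A$ is $r$. The $h$-vector of $A$ is $h(A)=(1,h_1,\dots,h_e)$ with $h_i=\dim_k A_i$ (so $h_1=r$). The socle of $A$ is $soc(A)=\{a\in A \mid a\,\overline{m}=0\}$, where $\overline{m}$ is the maximal homogeneous ideal of $A$; it is a homogeneous ideal, and the socle-vector of $A$ is $s(A)=(s_0,\dots,s_e)$ with $s_i=\dim_k soc(A)_i$ (so $s_0=0$ and $s_e=h_e>0$). For a vector $s=(0,s_1,\dots,s_e)$, an algebra has data $(r,s)$ if it has embedding dimension $r$ and socle-vector $s$; $\text{min.emb.dim.}(s)$ is the least integer $r$ for which there exists an algebra with data $(r,s)$. An $h$-vector $h$ is admissible for $(r,s)$ if it is the $h$-vector of some algebra with data $(r,s)$. $h$-vectors of the same length are partially ordered entrywise: $h\geq h'$ if every entry of $h$ is $\geq$ the corresponding entry of $h'$. If there is an admissible $h$-vector $h$ for $(r,s)$ with $h\geq h'$ for every other admissible $h'$ (i.e. a maximum), then any algebra with data $(r,s)$ and $h$-vector $h$ is called a generalized compressed algebra for $(r,s)$. Notation: $N(r,d)=\dim_k R_d=\binom{r-1+d}{d}$ for $d\geq 0$. For $d=0,1,\dots,e$, $$r_d=N(r,d)-N(r,0)s_d-N(r,1)s_{d+1}-\dots-N(r,e-d)s_e.$$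 For positive integers $n,i$, the $i$-binomial expansion of $n$ is the unique expression $n_{(i)}=\binom{n_i}{i}+\binom{n_{i-1}}{i-1}+\dots+\binom{n_j}{j}$ with $n_i>n_{i-1}>\dots>n_j\geq j\geq 1$; for an integer $a$, set $$(n_{(i)})_a^a=\binom{n_i+a}{i+a}+\binom{n_{i-1}+a}{i-1+a}+\dots+\binom{n_j+a}{j+a}.$$ *)

(* Defs.v *)
From HB Require Import structures.
From mathcomp Require Import all_boot all_order all_algebra.
From mathcomp Require Import ring_quotient mpoly.

Set Implicit Arguments.
Unset Strict Implicit.
Unset Printing Implicit Defensive.

Import GRing.Theory.
Local Open Scope ring_scope.
Local Open Scope quotient_scope.

(* The k-vector space structure of R/I, where R = k[x_1, ..., x_r]. *)
Section QuotientScaling.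
Variables (k : fieldType) (r : nat) (I : idealr {mpoly k[r]}).

Definition quot_scale (c : k) (a : {ideal_quot I}) : {ideal_quot I} :=
  \pi_({ideal_quot I}) c%:MP * a.

Fact quot_scaleA c d a : quot_scale c (quot_scale d a) = quot_scale (c * d) a.
Proof. by rewrite /quot_scale mulrA -rmorphM /= -mpolyCM. Qed.

Fact quot_scale1 : left_id 1 quot_scale.
Proof. by move=> a; rewrite /quot_scale rmorph1 mul1r. Qed.

Fact quot_scaleDr : right_distributive quot_scale +%R.
Proof. by move=> c a b; rewrite /quot_scale mulrDr. Qed.

Fact quot_scaleDl a : {morph quot_scale^~ a : c d / c + d}.
Proof. by move=> c d; rewrite /quot_scale mpolyCD rmorphD mulrDl. Qed.

HB.instance Definition _ :=
  GRing.Zmodule_isLmodule.Build k {ideal_quot I}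
    quot_scaleA quot_scale1 quot_scaleDr quot_scaleDl.

End QuotientScaling.

(* The library's \dim needs a finite-dimensional ambient space, which R/I is
   not for an arbitrary I; the argument S is meant to be a subspace of V. *)
Definition has_dim (k : fieldType) (V : lmodType k) (S : V -> Prop) (n : nat) :=
  exists2 b : 'I_n -> V, (forall i, S (b i)) &
    forall v, S v -> exists! c : {ffun 'I_n -> k}, v = \sum_i c i *: b i.

Section StandardGradedAlgebra.
Variables (k : fieldType) (r : nat) (I : idealr {mpoly k[r]}).
Local Notation A := {ideal_quot I}.

Definition homogeneous_ideal :=
  forall (f : {mpoly k[r]}) (d : nat), f \in I -> pihomog mdeg d f \in I.

Definition no_linear_form :=
  forall f : {mpoly k[r]}, f \is 1.-homog -> f \in I -> f = 0.

Definition component (d : nat) (a : A) : Prop :=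
  exists2 f : {mpoly k[r]}, f \is d.-homog & a = \pi_A f.

Definition max_homog_ideal (a : A) : Prop :=
  exists2 f : {mpoly k[r]}, f@_0%MM = 0 & a = \pi_A f.

Definition socle (a : A) : Prop :=
  forall b : A, max_homog_ideal b -> a * b = 0.

(* e is the last index with A_e <> 0; in particular A is artinian. *)
Definition last_degree (e : nat) :=
  (exists2 a, component e a & a != 0) /\
  (forall d a, (e < d)%N -> component d a -> a = 0).

Definition artinian_algebra (e : nat) :=
  [/\ homogeneous_ideal, no_linear_form & last_degree e].

Definition hvector (e : nat) (h : e.+1.-tuple nat) :=
  forall i, (i <= e)%N -> has_dim (component i) (nth 0%N h i).

Definition socle_vector (e : nat) (s : e.+1.-tuple nat) :=
  forall i, (i <= e)%N ->
    has_dim (fun a => component i a /\ socle a) (nth 0%N s i).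

Definition has_data (e : nat) (s : e.+1.-tuple nat) :=
  artinian_algebra e /\ socle_vector s.

End StandardGradedAlgebra.

Section Compressed.
Variables (k : fieldType) (e : nat).
Implicit Types (r m : nat) (s h : e.+1.-tuple nat).

Definition min_emb_dim s m :=
  (exists I : idealr {mpoly k[m]}, has_data I s) /\
  (forall r, (exists I : idealr {mpoly k[r]}, has_data I s) -> (m <= r)%N).

Definition admissible r s h :=
  exists2 I : idealr {mpoly k[r]}, has_data I s & hvector I h.

Definition max_admissible r s h :=
  admissible r s h /\
  forall h', admissible r s h' ->
    forall i, (i <= e)%N -> (nth 0%N h' i <= nth 0%N h i)%N.

Definition generalized_compressed r (I : idealr {mpoly k[r]}) s :=
  has_data I s /\ exists2 h, max_admissible r s h & hvector I h.

End Compressed.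

(* N(r, d) = dim_k R_d, for r > 0. *)
Definition numN (r d : nat) : nat := 'C(r.-1 + d, d).

Definition rnum (r e : nat) (s : e.+1.-tuple nat) (d : nat) : int :=
  (numN r d)%:Z - \sum_(d <= j < e.+1) (numN r (j - d) * nth 0%N s j)%N%:Z.

(* c = [:: n_i; n_(i-1); ...; n_j] lists the tops of the i-binomial expansion
   of n, so that j = i - (size c).-1. *)
Definition binomial_expansion (n i : nat) (c : seq nat) :=
  [/\ (0 < size c <= i)%N, sorted gtn c, (i - (size c).-1 <= last 0 c)%N
    & n = (\sum_(t < size c) 'C(nth 0 c t, i - t))%N].

(* (n_(i))_a^a for a >= 0, when c is the i-binomial expansion of n. *)
Definition shifted_expansion (c : seq nat) (i a : nat) : nat :=
  (\sum_(t < size c) 'C(nth 0 c t + a, i - t + a))%N.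

(* Main.v *)
(* Macaulay's inverse systems turn the problem into ranks of matrices.  An
   algebra with socle vector [s] is determined by one functional [F] on [R_e]
   and [s_p] functionals [G_l] on [R_p], and [h_i] is the rank of the matrix
   whose rows are the monomials of degree [i], whose columns are the pairs of a
   functional and a complementary monomial, and whose entries are the values of
   the functionals on the products.

   For [2p > e] this rank is at most the number of rows and of columns.  A
   family of functionals maximizing the sum of the ranks over all [i] attains
   both bounds: if [u] and [v] span part of the left and right kernels in some
   degree, the product of the polynomials they encode is nonzero, so a small
   perturbation of the functionals raises that rank without lowering others.

   For [2p <= e] the socle in degree [p] provides [s_p] forms of degree [p]
   annihilating [F]; comparing leading monomials, their multiples occupy at
   least [\sum_(l < s_p) N(r - l, a)] dimensions in degree [p + a], and the
   symmetry of the Hankel matrices of [F] transports this bound above [e / 2].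
   Equality holds when [F] is the sum of the evaluations at the grid points
   whose exponents avoid the lex ideal [x_1^(p-1) (x_1, ..., x_(s_p))]: by
   Newton interpolation the evaluation matrices at these points are
   triangular. *)
Require Import Defs.
From HB Require Import structures.
From mathcomp Require Import all_boot all_order all_algebra.
From mathcomp Require Import ring_quotient mpoly zify.

Set Implicit Arguments.
Unset Strict Implicit.
Unset Printing Implicit Defensive.

Import Order.TTheory GRing.Theory Num.Theory.
Local Open Scope ring_scope.

(** * Dimensions and ranks *)

(** Each basis is written in the other; by uniqueness of coordinates the two coordinate matrices
    multiply to the identity. *)
Lemma has_dim_leq (k : fieldType) (V : lmodType k) (S : V -> Prop) (n n' : nat) :
  has_dim S n -> has_dim S n' -> (n <= n')%N.
Proof.
move=> [b bS b_basis] [b' bS' b_basis'].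
have [c cE] := fin_all_exists (fun i => b_basis' _ (bS i)).
have [d dE] := fin_all_exists (fun i => b_basis _ (bS' i)).
apply: (@mulmx1_min _ _ _ (\matrix_(i, j) c i j) (\matrix_(i, j) d i j)).
apply/matrixP => i l; rewrite !mxE.
have [x [_ x_uniq]] := b_basis _ (bS i).
have e1 : b i = \sum_j [ffun j => (i == j)%:R] j *: b j :> V.
  rewrite (bigD1 i) //= ffunE eqxx scale1r big1 ?addr0 // => j ji.
  by rewrite ffunE eq_sym (negPf ji) scale0r.
have e2 : b i = \sum_l [ffun l => \sum_j c i j * d j l] l *: b l.
  rewrite {1}(proj1 (cE i)).
  transitivity (\sum_j \sum_l (c i j * d j l) *: b l).
    apply: eq_bigr => j _; rewrite {1}(proj1 (dE j)) scaler_sumr.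
    by apply: eq_bigr => l' _; rewrite scalerA.
  rewrite exchange_big /=; apply: eq_bigr => l' _.
  by rewrite ffunE scaler_suml.
have := etrans (esym (x_uniq _ e2)) (x_uniq _ e1).
move/ffunP/(_ l); rewrite !ffunE => <-.
by apply: eq_bigr => j _; rewrite !mxE.
Qed.

Lemma has_dim_unique (k : fieldType) (V : lmodType k) (S : V -> Prop) (n n' : nat) :
  has_dim S n -> has_dim S n' -> n = n'.
Proof. by move=> h h'; apply/eqP; rewrite eqn_leq !(@has_dim_leq k V S). Qed.

Definition lincomb (k : fieldType) (V : lmodType k) (m : nat) (b : 'I_m -> V)
  (v : 'rV[k]_m) : V := \sum_i v 0 i *: b i.

Lemma lincombB (k : fieldType) (V : lmodType k) (m : nat) (b : 'I_m -> V) v w :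
  lincomb b (v - w) = lincomb b v - lincomb b w.
Proof.
rewrite /lincomb -sumrB; apply: eq_bigr => i _.
by rewrite !mxE scalerBl.
Qed.

Lemma lincombM (k : fieldType) (V : lmodType k) (m n : nat) (b : 'I_m -> V)
  (w : 'rV_n) (Y : 'M_(n, m)) :
  lincomb b (w *m Y) = \sum_i w 0 i *: lincomb b (row i Y).
Proof.
rewrite /lincomb; under eq_bigr do rewrite mxE scaler_suml.
rewrite exchange_big /=; apply: eq_bigr => i _.
by rewrite scaler_sumr; apply: eq_bigr => j _; rewrite !mxE scalerA.
Qed.

(** [S] is the image of the row space of [U], and [K] has the same kernel as [lincomb b], so [S] is
    isomorphic to the row space of [U *m K]. *)
Lemma has_dim_rank (k : fieldType) (V : lmodType k) (S : V -> Prop) (l m q : nat)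
  (b : 'I_m -> V) (U : 'M[k]_(l, m)) (K : 'M[k]_(m, q)) :
  (forall a, S a <-> exists2 v, (v <= U)%MS & a = lincomb b v) ->
  (forall v, lincomb b v = 0 <-> v *m K = 0) ->
  has_dim S (\rank (U *m K)).
Proof.
move=> SE KE; set W := row_base (U *m K).
(* [Y] lifts a basis of the row space of [U *m K] to rows in the row space of [U]. *)
set Y := W *m pinvmx (U *m K) *m U.
have YK : Y *m K = W by rewrite -mulmxA mulmxKpV // eq_row_base.
exists (fun i => lincomb b (row i Y)) => [i|a /SE [v vU ->]].
  by apply/SE; exists (row i Y) => //; rewrite (submx_trans (row_sub _ _)) ?submxMl.
have vW : (v *m K <= W)%MS by rewrite eq_row_base submxMr.
have uniq_lincomb (w w' : 'rV_ _) : lincomb b (w *m Y) = lincomb b (w' *m Y) -> w = w'.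
  move/eqP; rewrite -subr_eq0 -lincombB -mulmxBl => /eqP /KE.
  rewrite -mulmxA YK => /eqP.
  by rewrite mulmx_free_eq0 ?row_base_free // subr_eq0 => /eqP.
set w := v *m K *m pinvmx W.
have vE : lincomb b v = lincomb b (w *m Y).
  apply/eqP; rewrite -subr_eq0 -lincombB; apply/eqP/KE.
  by rewrite mulmxBl -(mulmxA w) YK mulmxKpV // subrr.
have ffE (c : {ffun 'I_(\rank (U *m K)) -> k}) :
    \sum_i c i *: lincomb b (row i Y) = lincomb b (\row_i c i *m Y).
  by rewrite lincombM; apply: eq_bigr => i _; rewrite mxE.
exists [ffun i => w 0 i]; split => [|c].
  rewrite vE lincombM; apply: eq_bigr => i _; by rewrite ffunE.
rewrite vE ffE => /uniq_lincomb wE; apply/ffunP => i.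
by rewrite ffunE wE mxE.
Qed.

(** In a vanishing combination of rows, take the nonzero coefficient of largest key: its column
    receives only the diagonal term. *)
Lemma row_free_triangular (k : fieldType) (d : Order.disp_t) (T : orderType d) (n : nat)
  (key : 'I_n -> T) (A : 'M[k]_n) :
  (forall i, A i i != 0) ->
  (forall i j, A i j != 0 -> i != j -> (key j < key i)%O) ->
  row_free A.
Proof.
move=> Ad At; apply/inj_row_free => v vA0; apply/eqP/negPn/negP => vn0.
have /existsP [i0 vi0] : [exists i, v 0 i != 0].
  apply: contraNT vn0 => /existsPn v0; apply/eqP/rowP => i.
  by rewrite mxE; apply/eqP/negPn/v0.
case: (@arg_maxP _ _ _ i0 (fun i => v 0 i != 0) key vi0) => i vi imax.
have := congr1 (fun w : 'rV_n => w 0 i) vA0; rewrite !mxE (bigD1 i) //= big1.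
  by rewrite addr0 => /eqP; rewrite mulf_eq0 (negPf vi) (negPf (Ad i)).
move=> j ji; apply/eqP; rewrite mulf_eq0; apply/negPn/negP.
rewrite negb_or => /andP [/imax ij /At /(_ ji)].
by rewrite ltNge (ij : (key j <= key i)%O).
Qed.

Lemma natr_inj_char0 (k : fieldType) (i j : nat) :
  [pchar k] =i pred0 -> (i%:R == j%:R :> k) = (i == j).
Proof.
move=> char0; wlog le : i j / (i <= j)%N => [wl|].
  by case/orP: (leq_total i j) => le; rewrite ?(wl _ _ le) // eq_sym wl // eq_sym.
rewrite eq_sym -subr_eq0 -natrB //; move/pcharf0P: char0 => ->.
by rewrite subn_eq0 eqn_leq le.
Qed.

(** In characteristic zero the first [size q] integers are distinct, too many to be all roots. *)
Lemma exists_nonroot (k : fieldType) (q : {poly k}) :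
  [pchar k] =i pred0 -> q != 0 -> exists t, q.[t] != 0.
Proof.
move=> char0 q0; pose rs := [seq n%:R : k | n <- iota 0 (size q)].
have rs_uniq : uniq rs.
  by rewrite map_inj_uniq ?iota_uniq // => n n' /eqP; rewrite natr_inj_char0 // => /eqP.
have : ~~ all (root q) rs.
  apply/negP => /(max_poly_roots q0) /(_ rs_uniq).
  by rewrite size_map size_iota ltnn.
by case/allPn => t _ qt; exists t.
Qed.

Lemma eq_ker_rank (k : fieldType) (m q q' : nat) (K : 'M[k]_(m, q)) (K' : 'M_(m, q')) :
  (forall v : 'rV_m, v *m K = 0 <-> v *m K' = 0) -> \rank K = \rank K'.
Proof.
move=> vE; suff : \rank (kermx K) = \rank (kermx K').
  by rewrite !mxrank_ker => /(congr1 (subn m)); rewrite !subKn ?rank_leq_row.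
apply/eqmx_rank/andP; split; apply/sub_kermxP/row_matrixP => x;
  rewrite row_mul row0; apply/vE; exact/sub_kermxP/row_sub.
Qed.

Lemma rank_normal (k : fieldType) (m n : nat) (A : 'M[k]_(m, n)) :
  exists L : 'M_(\rank A, m), exists R : 'M_(n, \rank A), L *m A *m R = 1%:M.
Proof.
exists (pinvmx (col_base A)), (pinvmx (row_base A)).
have <- : pinvmx (col_base A) *m (col_base A *m row_base A) *m pinvmx (row_base A)
  = pinvmx (col_base A) *m A *m pinvmx (row_base A) by rewrite mulmx_base.
by rewrite mulmxA mulVpmx ?mul1mx ?mulmxVp ?row_base_free ?col_base_full.
Qed.

Lemma det_neq0_leq_rank (k : fieldType) (m n q : nat) (L : 'M[k]_(q, m))
  (A : 'M_(m, n)) (R : 'M_(n, q)) :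
  \det (L *m A *m R) != 0 -> (q <= \rank A)%N.
Proof.
rewrite -unitfE -unitmxE => /mxrank_unit {1}<-.
by rewrite (leq_trans (mxrankM_maxl _ _)) ?mxrankM_maxr.
Qed.

(** With [L] and [R] from [rank_normal], the determinant of [L *m (A + t *: B) *m R] is a polynomial
    in [t] with value 1 at [t = 0]. *)
Lemma rank_perturb (k : fieldType) (m n : nat) (A B : 'M[k]_(m, n)) :
  exists2 q : {poly k}, q != 0 &
    forall t, q.[t] != 0 -> (\rank A <= \rank (A + t *: B)%R)%N.
Proof.
have [L [R LAR]] := rank_normal A.
pose P := map_mx polyC 1%:M + 'X *: map_mx polyC (L *m B *m R).
have PE t : (\det P).[t] = \det (L *m (A + t *: B) *m R).
  rewrite -horner_evalE -det_map_mx; congr (\det _).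
  rewrite mulmxDr mulmxDl LAR -scalemxAr -scalemxAl.
  by apply/matrixP => i j; rewrite !mxE /= horner_evalE !hornerE.
exists (\det P) => [|t].
  apply/eqP => /(congr1 (fun q => q.[0])).
  by rewrite PE scale0r addr0 LAR det1 horner0 => /eqP; rewrite oner_eq0.
by rewrite PE => /det_neq0_leq_rank.
Qed.

(** The normal form of [A] is bordered by the kernel vectors [u] and [v]; the larger determinant
    vanishes at 0 only to first order because [u *m B *m v] is nonzero. *)
Lemma rank_perturb_lt (k : fieldType) (m n : nat) (A B : 'M[k]_(m, n))
  (u : 'rV_m) (v : 'cV_n) :
  u *m A = 0 -> A *m v = 0 -> u *m B *m v != 0 ->
  exists2 q : {poly k}, q != 0 &
    forall t, q.[t] != 0 -> (\rank A < \rank (A + t *: B)%R)%N.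
Proof.
move=> uA Av uBv.
have [L [R LAR]] := rank_normal A.
(* [P] is the bordered matrix with a factor [t] taken out of its last row, which is divisible by [t]
   since [u *m A = 0]. *)
pose P : 'M[{poly k}]_(\rank A + 1) :=
  block_mx (map_mx polyC 1%:M + 'X *: map_mx polyC (L *m B *m R))
    ('X *: map_mx polyC (L *m B *m v)) (map_mx polyC (u *m B *m R))
    (map_mx polyC (u *m B *m v)).
have PE t : map_mx (horner_eval t) P =
    block_mx (1%:M + t *: (L *m B *m R)) (t *: (L *m B *m v)) (u *m B *m R) (u *m B *m v).
  rewrite map_block_mx; congr block_mx; apply/matrixP => i j;
  by rewrite !mxE /= ?horner_evalE ?hornerE.
have ME t : col_mx L u *m (A + t *: B) *m row_mx R v =
    block_mx 1%:M 0 0 t%:M *m map_mx (horner_eval t) P.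
  rewrite PE mulmx_block !mul1mx !mul0mx !addr0 !add0r mul_col_mx mul_col_row.
  rewrite !mulmxDr !mulmxDl LAR -!scalemxAr -!scalemxAl uA -!mulmxA Av !mulmx0.
  by rewrite !mul0mx !add0r !mul_scalar_mx.
exists ('X * \det P) => [|t].
  rewrite mulf_neq0 ?polyX_eq0 //; apply/eqP => /(congr1 (fun q => q.[0])).
  rewrite horner0 -horner_evalE -det_map_mx PE !scale0r addr0 det_lblock det1 mul1r.
  rewrite det_mx11 => /eqP; apply/negP; apply: contra uBv => /eqP e.
  by apply/eqP/rowP => i; rewrite !ord1 e mxE.
rewrite hornerM hornerX -horner_evalE -det_map_mx => qt.
have : \det (col_mx L u *m (A + t *: B) *m row_mx R v) != 0.
  by rewrite ME det_mulmx det_lblock det1 mul1r det_scalar1.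
by move=> /det_neq0_leq_rank; rewrite addn1.
Qed.

(** * Monomials of a given degree *)

Definition monos (r d : nat) : seq 'X_{1..r} :=
  [seq bmnm m | m : 'X_{1..r < d.+1} <- enum {: 'X_{1..r < d.+1}} & mdeg m == d].

Lemma mem_monos (r d : nat) (m : 'X_{1..r}) : (m \in monos r d) = (mdeg m == d).
Proof.
apply/mapP/eqP => [[m'] |md]; first by rewrite mem_filter => /andP [/eqP md _ ->].
have lt : (mdeg m < d.+1)%N by rewrite md.
by exists (BMultinom lt); rewrite // mem_filter mem_enum /= md eqxx.
Qed.

Lemma monos_uniq (r d : nat) : uniq (monos r d).
Proof. by rewrite map_inj_uniq => [|m m' /val_inj //]; apply/filter_uniq/enum_uniq. Qed.

Definition monos_on (r : nat) (W : {set 'I_r}) (d : nat) : seq 'X_{1..r} :=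
  [seq m : 'X_{1..r} <- monos r d | [forall i, (m i != 0%N) ==> (i \in W)]].

Lemma mem_monos_on (r : nat) (W : {set 'I_r}) (d : nat) (m : 'X_{1..r}) :
  (m \in monos_on W d) = (mdeg m == d) && [forall i, (m i != 0%N) ==> (i \in W)].
Proof. by rewrite mem_filter mem_monos andbC. Qed.

Lemma monos_on_uniq (r : nat) (W : {set 'I_r}) (d : nat) : uniq (monos_on W d).
Proof. by rewrite filter_uniq ?monos_uniq. Qed.

Lemma monos_onT (r d : nat) : monos_on [set: 'I_r] d = monos r d.
Proof.
by apply/all_filterP/allP => m _; apply/forallP => i; rewrite inE implybT.
Qed.

Lemma size_monos_on0 (r : nat) (W : {set 'I_r}) : size (monos_on W 0) = 1%N.
Proof.
rewrite -[RHS]/(size [:: 0%MM : 'X_{1..r}]); apply/perm_size/uniq_perm => //.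
  exact: monos_on_uniq.
move=> m; rewrite mem_monos_on mdeg_eq0 inE; case: eqP => //= ->.
by apply/forallP => i; rewrite mnm0E.
Qed.

Lemma size_monos_on_set0 (r d : nat) : size (monos_on (set0 : {set 'I_r}) d.+1) = 0%N.
Proof.
apply/eqP; rewrite size_eq0 -(negbK (_ == _)) -has_filter; apply/hasPn => m.
rewrite mem_monos => md; apply/negP => /forallP m0.
move: md; have /eqP -> : mdeg m == 0%N; last by [].
rewrite mdeg_eq0; apply/eqP/mnmP => i; rewrite mnm0E; apply/eqP.
by have := m0 i; rewrite inE implybF negbK.
Qed.

(** Split according to whether [x] divides the monomial, and divide by [x] when it does. *)
Lemma size_monos_onS (r : nat) (W : {set 'I_r}) (d : nat) (x : 'I_r) : x \in W ->
  size (monos_on W d.+1) = (size (monos_on (W :\ x) d.+1) + size (monos_on W d))%N.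
Proof.
move=> xW; rewrite -[X in (_ + X)%N](size_map (fun m => m + U_(x))%MM) -size_cat.
have inj : injective (fun m : 'X_{1..r} => m + U_(x))%MM.
  by move=> m m' /(congr1 (fun n => n - U_(x))%MM); rewrite !addmK.
apply/perm_size/uniq_perm; first exact: monos_on_uniq.
  rewrite cat_uniq !monos_on_uniq map_inj_uniq // monos_on_uniq andbT /=.
  apply/hasPn => _ /mapP [m _ ->]; rewrite mem_monos_on negb_and; apply/orP; right.
  by apply/forallPn; exists x; rewrite !inE mnmDE mnm1E eqxx addn1.
move=> m; rewrite mem_cat !mem_monos_on; case: (posnP (m x)) => [mx0|mx].
  have -> : (m \in [seq (m + U_(x))%MM | m <- monos_on W d]) = false.
    apply/mapP => -[m' _ /mnmP /(_ x)].
    by rewrite mnmDE mnm1E eqxx addn1 mx0.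
  rewrite orbF; congr andb; apply: eq_forallb => i; rewrite !inE.
  by case: (altP (i =P x)) => [->|]; rewrite ?mx0 //= andbT.
have -> : [forall i, (m i != 0%N) ==> (i \in W :\ x)] = false.
  by apply/forallPn; exists x; rewrite !inE eqxx implybF negbK -lt0n.
rewrite andbF /=.
have Ux : (U_(x) <= m)%MM.
  by apply/mnm_lepP => i; rewrite mnm1E; case: eqP => // <-.
have mE : m = (m - U_(x) + U_(x))%MM by rewrite submK.
have -> : (m \in [seq (m + U_(x))%MM | m <- monos_on W d])
    = (m - U_(x) \in monos_on W d)%MM by rewrite {1}mE (mem_map inj).
rewrite mem_monos_on.
have -> : (mdeg m == d.+1) = (mdeg (m - U_(x)) == d).
  by rewrite {1}mE mdegD mdeg1 addn1.
congr andb; apply: eq_forallb => i; rewrite mnmBE mnm1E.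
case: (altP (x =P i)) => [<-|_]; rewrite ?subn0 // xW !implybT //.
Qed.

Lemma numN0 (q : nat) : numN q 0 = 1%N.
Proof. by rewrite /numN bin0. Qed.

Lemma numN1 (q : nat) : (0 < q)%N -> numN q 1 = q.
Proof. by case: q => // q _; rewrite /numN bin1 /= addn1. Qed.

Lemma numN1d (d : nat) : numN 1 d = 1%N.
Proof. by rewrite /numN add0n binn. Qed.

Lemma numNS (q d : nat) : (0 < q)%N ->
  numN q.+1 d.+1 = (numN q d.+1 + numN q.+1 d)%N.
Proof. by case: q => // q _; rewrite /numN /= addnS binS addSnnS. Qed.

Lemma numN_gt0 (q d : nat) : (0 < numN q d)%N.
Proof. by rewrite bin_gt0 leq_addl. Qed.

Lemma leq_numN (q d d' : nat) : (d <= d')%N -> (numN q d <= numN q d')%N.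
Proof.
move=> dd'; rewrite /numN.
rewrite -(bin_sub (leq_addl q.-1 d)) -(bin_sub (leq_addl q.-1 d')) !addnK.
by rewrite leq_bin2l // leq_add2l.
Qed.

Lemma leq_numN_l (q q' d : nat) : (q <= q')%N -> (numN q d <= numN q' d)%N.
Proof. by move=> qq'; rewrite /numN leq_bin2l // leq_add2r -!subn1 leq_sub2r. Qed.

Lemma size_monos_on (r : nat) (W : {set 'I_r}) (d : nat) :
  (0 < #|W|)%N -> size (monos_on W d) = numN #|W| d.
Proof.
move Eq : #|W| => q; elim: q d W Eq => // q IHq; elim=> [|d IHd] W Wq _.
  by rewrite size_monos_on0 numN0.
have [x xW] : exists x, x \in W by apply/card_gt0P; rewrite Wq.
have Wxq : #|W :\ x| = q by move: Wq; rewrite (cardsD1 x) xW add1n => -[].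
rewrite (size_monos_onS _ xW) IHd //; case: (posnP q) => [q0|q_gt0].
  move: Wxq; rewrite q0 => /cards0_eq ->.
  by rewrite size_monos_on_set0 !numN1d.
by rewrite IHq // numNS.
Qed.

Lemma size_monos (r d : nat) : (0 < r)%N -> size (monos r d) = numN r d.
Proof. by move=> r0; rewrite -monos_onT size_monos_on cardsT card_ord. Qed.

(** * Coordinates of forms in the monomial basis *)

Section MonomialBasis.
Variables (k : fieldType) (r : nat).

Definition mon (d : nat) (x : 'I_(size (monos r d))) : 'X_{1..r} :=
  nth 0%MM (monos r d) x.

Lemma mdeg_mon (d : nat) (x : 'I_(size (monos r d))) : mdeg (mon x) = d.
Proof. by apply/eqP; rewrite -mem_monos mem_nth. Qed.

Lemma mon_inj (d : nat) : injective (@mon d).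
Proof.
move=> x y /eqP; rewrite /mon nth_uniq ?monos_uniq // => /eqP xy.
exact: val_inj.
Qed.

Lemma monP (d : nat) (m : 'X_{1..r}) : mdeg m = d -> exists x, m = @mon d x.
Proof.
move=> /eqP; rewrite -mem_monos => /(nthP 0%MM) [x lt mE].
by exists (Ordinal lt).
Qed.

Definition rpoly (d : nat) (v : 'rV[k]_(size (monos r d))) : {mpoly k[r]} :=
  lincomb (fun x => 'X_[mon x]) v.

Definition prow (d : nat) (f : {mpoly k[r]}) : 'rV[k]_(size (monos r d)) :=
  \row_x f@_(mon x).

Lemma rpoly_homog (d : nat) (v : 'rV_(size (monos r d))) : rpoly v \is d.-homog.
Proof.
apply: rpred_sum => x _; apply: rpredZ.
by rewrite dhomogX; apply/eqP/mdeg_mon.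
Qed.

Lemma mcoeff_rpoly (d : nat) (v : 'rV_(size (monos r d))) x : (rpoly v)@_(mon x) = v 0 x.
Proof.
rewrite /rpoly /lincomb raddf_sum /= (bigD1 x) //= big1 => [|y yx].
  by rewrite mcoeffZ mcoeffX eqxx mulr1 addr0.
by rewrite mcoeffZ mcoeffX (inj_eq (@mon_inj d)) (negPf yx) mulr0.
Qed.

Lemma rpolyK (d : nat) (v : 'rV_(size (monos r d))) : prow d (rpoly v) = v.
Proof. by apply/rowP => x; rewrite mxE mcoeff_rpoly. Qed.

Lemma prowK (d : nat) (f : {mpoly k[r]}) : f \is d.-homog -> rpoly (prow d f) = f.
Proof.
move=> f_homog; apply/mpolyP => m; case: (eqVneq (mdeg m) d) => [/monP [x ->]|md].
  by rewrite mcoeff_rpoly mxE.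
by rewrite !(dhomog_nemf_coeff _ md) // rpoly_homog.
Qed.

Lemma rpoly0 (d : nat) : rpoly (0 : 'rV_(size (monos r d))) = 0.
Proof. by rewrite /rpoly /lincomb big1 // => x _; rewrite mxE scale0r. Qed.

Lemma rpoly_eq0 (d : nat) (v : 'rV_(size (monos r d))) : (rpoly v == 0) = (v == 0).
Proof.
apply/eqP/eqP => [v0|->]; last exact: rpoly0.
by rewrite -(rpolyK v) v0; apply/rowP => x; rewrite !mxE mcoeff0.
Qed.

End MonomialBasis.

(** * Catalecticant matrices *)

Section Functionals.
Variables (k : fieldType) (r : nat).
Implicit Types (c : 'X_{1..r} -> k) (f : {mpoly k[r]}).

(** The functional of degree [d] with values [c] on monomials; it kills all other degrees. *)
Definition act (d : nat) c f : k := \sum_(m <- monos r d) f@_m * c m.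

Lemma actD d c f g : act d c (f + g) = act d c f + act d c g.
Proof.
by rewrite /act -big_split; apply: eq_bigr => m _; rewrite mcoeffD mulrDl.
Qed.

Lemma actZ d c a f : act d c (a *: f) = a * act d c f.
Proof.
by rewrite /act mulr_sumr; apply: eq_bigr => m _; rewrite mcoeffZ mulrA.
Qed.

Lemma act0 d c : act d c 0 = 0.
Proof. by rewrite -(scale0r 0) actZ mul0r. Qed.

Lemma act_sum d c (T : Type) (s : seq T) (P : pred T) (F : T -> {mpoly k[r]}) :
  act d c (\sum_(x <- s | P x) F x) = \sum_(x <- s | P x) act d c (F x).
Proof. exact: (big_morph _ (actD d c) (act0 d c)). Qed.

Lemma actX d c m : act d c 'X_[m] = if mdeg m == d then c m else 0.
Proof.
rewrite /act; case: ifP => md.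
  rewrite (bigD1_seq m) ?mem_monos ?monos_uniq //= mcoeffX eqxx mul1r.
  by rewrite big1 ?addr0 // => m' m'm; rewrite mcoeffX eq_sym (negPf m'm) mul0r.
rewrite big_seq big1 // => m'; rewrite mem_monos mcoeffX.
by case: (m =P m') => [<-|_]; rewrite ?md // mul0r.
Qed.

Lemma act_homog_neq d c f i : f \is i.-homog -> i != d -> act d c f = 0.
Proof.
move=> f_homog id; rewrite /act big_seq big1 // => m.
rewrite mem_monos => /eqP md; rewrite (dhomog_nemf_coeff f_homog) ?mul0r //.
by rewrite /= md eq_sym.
Qed.

Lemma act_rpoly d c i (v : 'rV_(size (monos r i))) m : (i + mdeg m)%N = d ->
  act d c (rpoly v * 'X_[m]) = \sum_x v 0 x * c (mon x + m)%MM.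
Proof.
move=> imd; rewrite /rpoly /lincomb mulr_suml act_sum; apply: eq_bigr => x _.
by rewrite -scalerAl -mpolyXD actZ actX mdegD mdeg_mon imd eqxx.
Qed.

End Functionals.

Section Catalecticant.
Variables (k : fieldType) (r : nat) (L : finType) (dg : L -> nat).
Implicit Types (c : L -> 'X_{1..r} -> k) (T : seq (L * 'X_{1..r})).

(* [c l] is the l-th generator of an inverse system, of degree [dg l]; a column
   [(l, m)] stands for its contraction by [m]. *)
Definition cols (i : nat) : seq (L * 'X_{1..r}) :=
  [seq (l, m) | l <- enum L, m <- if (i <= dg l)%N then monos r (dg l - i) else [::]].

(** Contractions by nonconstant monomials only; the forms of degree [i] that they kill represent the
    socle in degree [i]. *)
Definition cols_gt (i : nat) := [seq lm <- cols i | (i < dg lm.1)%N].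

Lemma mem_cols i lm : (lm \in cols i) = (i + mdeg lm.2 == dg lm.1)%N.
Proof.
case: lm => l m /=; apply/allpairsPdep/eqP => [[l' [m' [_ + [-> ->]]]]|imd].
  by case: ifP => // le; rewrite mem_monos => /eqP ->; rewrite subnKC.
exists l, m; rewrite mem_enum -imd leq_addr mem_monos; split => //.
by rewrite addKn.
Qed.

Lemma mem_cols_gt i lm :
  (lm \in cols_gt i) = (i < dg lm.1)%N && (i + mdeg lm.2 == dg lm.1)%N.
Proof. by rewrite mem_filter mem_cols. Qed.

Lemma size_cols i : (0 < r)%N ->
  size (cols i) = (\sum_(l : L) if (i <= dg l)%N then numN r (dg l - i) else 0)%N.
Proof.
move=> r0; rewrite size_allpairs_dep sumnE big_map big_enum /=.
by apply: eq_bigr => l _; case: ifP => //; rewrite size_monos.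
Qed.

Definition colmx c i T : 'M[k]_(size (monos r i), size T) :=
  \matrix_(x, y) let lm := tnth (in_tuple T) y in c lm.1 (mon x + lm.2)%MM.

Lemma mul_colmx_eq0 c i T (v : 'rV_(size (monos r i))) :
  v *m colmx c i T = 0 <->
  forall lm, lm \in T -> \sum_x v 0 x * c lm.1 (mon x + lm.2)%MM = 0.
Proof.
split=> [v0 lm lmT|v0].
  have /tnthP [y ->] : lm \in in_tuple T by [].
  have /rowP /(_ y) := v0; rewrite mxE [RHS]mxE => vy; rewrite -{}[RHS]vy.
  by apply: eq_bigr => x _; rewrite mxE.
apply/rowP => y; rewrite mxE [RHS]mxE -[RHS](v0 (tnth (in_tuple T) y)) ?mem_tnth //.
by apply: eq_bigr => x _; rewrite mxE.
Qed.

Lemma rank_colmx_mem c i T T' : T =i T' -> \rank (colmx c i T) = \rank (colmx c i T').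
Proof.
move=> TT'; apply: eq_ker_rank => v; rewrite !mul_colmx_eq0.
by split=> v0 lm lmT; apply: v0; rewrite ?TT' // -TT'.
Qed.

Definition catmx c i := colmx c i (cols i).
Definition catmx_gt c i := colmx c i (cols_gt i).

Lemma mul_catmx_eq0 c i (v : 'rV_(size (monos r i))) :
  v *m catmx c i = 0 <->
  forall l m, (i + mdeg m)%N = dg l -> act (dg l) (c l) (rpoly v * 'X_[m]) = 0.
Proof.
rewrite mul_colmx_eq0; split=> [v0 l m ilm|v0 lm].
  by rewrite act_rpoly //; apply: (v0 (l, m)); rewrite mem_cols ilm.
by rewrite mem_cols => /eqP ilm; rewrite -(act_rpoly _ _ ilm) v0.
Qed.

End Catalecticant.

(** * Graded components and socle of a quotient *)

Section QuotientComponents.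
Local Open Scope quotient_scope.
Variables (k : fieldType) (r : nat) (I : idealr {mpoly k[r]}).
Local Notation A := {ideal_quot I}.

Lemma pi_eq0 f : \pi_A f = 0 <-> f \in I.
Proof.
rewrite -[f]subr0 Quotient.idealrBE subr0 raddf0.
by split => [->|/eqP]; rewrite ?raddf0.
Qed.

Lemma pi_scale (a : k) f : \pi_A (a *: f) = a *: \pi_A f.
Proof. by rewrite -mul_mpolyC rmorphM. Qed.

Lemma pi_rpoly i (v : 'rV_(size (monos r i))) :
  \pi_A (rpoly v) = lincomb (fun x => \pi_A 'X_[mon x]) v.
Proof.
by rewrite /rpoly /lincomb raddf_sum; apply: eq_bigr => x _; rewrite -pi_scale.
Qed.

Lemma componentP i (a : A) :
  component i a <-> exists v : 'rV_(size (monos r i)), a = \pi_A (rpoly v).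
Proof.
split=> [[f f_homog ->]|[v ->]]; last by exists (rpoly v); rewrite // rpoly_homog.
by exists (prow i f); rewrite prowK.
Qed.

(** A polynomial without constant term lies in the ideal of the variables, so testing against the
    variables suffices. *)
Lemma socle_pi f : socle (\pi_A f) <-> forall j, f * 'X_j \in I.
Proof.
split=> [fs j|fI _ [g g0 ->]].
  apply/pi_eq0; rewrite rmorphM; apply: fs; exists 'X_j => //.
  by rewrite mcoeffX mnm1_eq0.
rewrite -rmorphM; apply/pi_eq0; rewrite [g]mpolyE mulr_sumr.
rewrite rpred_sum // => m _; case: (eqVneq m 0%MM) => [->|m0].
  by rewrite g0 scale0r mulr0 rpred0.
have /existsP [j mj] : [exists j, m j != 0%N].
  apply: contraNT m0 => /existsPn m0; apply/eqP/mnmP => j.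
  by rewrite mnm0E; apply/eqP/negPn/m0.
have -> : m = (U_(j) + (m - U_(j)))%MM.
  rewrite addmC submK //; apply/mnm_lepP => j'; rewrite mnm1E.
  by case: eqP => // <-; rewrite lt0n.
by rewrite -scalerAr mpolyXD mulrA -mul_mpolyC idealMr // mulrC idealMr.
Qed.

Lemma has_dim_component i q (K : 'M_(size (monos r i), q)) :
  (forall v, rpoly v \in I <-> v *m K = 0) ->
  has_dim (@component k r I i) (\rank K).
Proof.
move=> KE; rewrite -{1}(mul1mx K).
apply: (@has_dim_rank _ _ _ _ _ _ (fun x => \pi_A 'X_[mon x])) => [a|v].
  rewrite componentP; split=> [[v ->]|[v _ ->]]; last by exists v; rewrite pi_rpoly.
  by exists v; rewrite ?submx1 ?pi_rpoly.
by rewrite -pi_rpoly pi_eq0.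
Qed.

Lemma has_dim_socle i l q (U : 'M_(l, _)) (K : 'M_(size (monos r i), q)) :
  (forall v, (v <= U)%MS <-> forall j, rpoly v * 'X_j \in I) ->
  (forall v, rpoly v \in I <-> v *m K = 0) ->
  has_dim (fun a => component i a /\ @socle k r I a) (\rank (U *m K)).
Proof.
move=> UE KE.
apply: (@has_dim_rank _ _ _ _ _ _ (fun x => \pi_A 'X_[mon x])) => [a|v].
  rewrite componentP; split=> [[[v ->] /socle_pi /UE vU]|[v vU ->]].
    by exists v; rewrite ?pi_rpoly.
  by rewrite -pi_rpoly; split; [exists v|apply/socle_pi/UE].
by rewrite -pi_rpoly pi_eq0.
Qed.

End QuotientComponents.

(** * The algebra of an inverse system *)

Section Annihilator.
Local Open Scope quotient_scope.
Variables (k : fieldType) (r : nat) (L : finType) (dg : L -> nat).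
Variable c : L -> 'X_{1..r} -> k.

(* Bounding the degree of [m] makes membership boolean; larger monomials give 0. *)
Definition annihilator : pred {mpoly k[r]} := fun f =>
  [forall l, forall m : 'X_{1..r < (\max_l dg l).+1},
     act (dg l) (c l) (f * 'X_[m]) == 0].

Lemma act_mulX_gt l (f : {mpoly k[r]}) m :
  (dg l < mdeg m)%N -> act (dg l) (c l) (f * 'X_[m]) = 0.
Proof.
move=> lt; rewrite [f]mpolyE mulr_suml act_sum big1 // => m' _.
rewrite -scalerAl -mpolyXD actZ actX mdegD eqn_leq [X in X && _]leqNgt.
by rewrite (leq_trans lt) ?leq_addl ?mulr0.
Qed.

Lemma annihilatorP f :
  reflect (forall l g, act (dg l) (c l) (f * g) = 0) (annihilator f).
Proof.
apply: (iffP forallP) => [f0 l g|f0 l]; last by apply/forallP => m; apply/eqP.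
rewrite [g]mpolyE mulr_sumr act_sum big1 // => m _.
rewrite -scalerAr actZ; case: (leqP (mdeg m) (\max_l dg l)) => [le|lt].
  have lt : (mdeg m < (\max_l dg l).+1)%N by [].
  by have /forallP /(_ (BMultinom lt)) /eqP /= -> := f0 l; rewrite mulr0.
by rewrite act_mulX_gt ?mulr0 // (leq_ltn_trans _ lt) // leq_bigmax.
Qed.

Lemma annihilator_homog i (v : 'rV_(size (monos r i))) :
  annihilator (rpoly v) <-> v *m catmx dg c i = 0.
Proof.
rewrite mul_catmx_eq0; split=> [/annihilatorP v0 l m _ //|v0].
apply/annihilatorP => l g; rewrite [g]mpolyE mulr_sumr act_sum big1 // => m _.
rewrite -scalerAr actZ; case: (eqVneq (i + mdeg m)%N (dg l)) => [/v0 ->|im].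
  by rewrite mulr0.
rewrite (act_homog_neq _ _ im) ?mulr0 // dhomogM ?rpoly_homog //.
by rewrite dhomogX.
Qed.

Lemma annihilator_closed : (exists l m, mdeg m = dg l /\ c l m != 0) ->
  idealr_closed annihilator.
Proof.
move=> [l [m [md cm]]]; split => [||a f g /annihilatorP f0 /annihilatorP g0].
- by apply/annihilatorP => l' g; rewrite mul0r act0.
- apply: contraNN cm => /annihilatorP /(_ l 'X_[m]).
  by rewrite mul1r actX md eqxx => ->.
apply/annihilatorP => l' h.
by rewrite mulrDl actD g0 addr0 mulrAC mulrC f0.
Qed.

(** Paired with [c l], the product [f * 'X_[m]] only sees the component of [f] of degree
    [dg l - mdeg m]. *)
Lemma pihomog_annihilator f d : annihilator f -> annihilator (pihomog mdeg d f).
Proof.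
move=> /annihilatorP f0.
have fd := pihomogP mdeg d f.
rewrite -(prowK fd); apply/annihilator_homog/mul_catmx_eq0 => l m dm.
rewrite prowK //.
have neq0 i : i != d -> act (dg l) (c l) (pihomog mdeg i f * 'X_[m]) = 0.
  move=> id; have im : (i + mdeg m)%N != dg l by rewrite -dm eqn_add2r.
  by apply: act_homog_neq im; rewrite dhomogM ?pihomogP ?dhomogX.
(* [K] exceeds [d] and every degree in [f], so the components below [K] sum to [f] and include the
   one of degree [d]. *)
pose K := maxn (mmeasure mdeg f) d.+1.
have dK : (d < K)%N by rewrite leq_maxr.
transitivity (\sum_(i < K) act (dg l) (c l) (pihomog mdeg i f * 'X_[m])).
  rewrite (bigD1 (Ordinal dK)) //= big1 ?addr0 // => i id.
  by apply: neq0; apply: contraNneq id => e; apply/eqP/val_inj.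
rewrite -act_sum -mulr_suml -pihomog_partitionE ?f0 //.
exact: leq_maxl.
Qed.

(** Every column of [catmx_gt] contracts by a monomial divisible by some variable. *)
Lemma mul_catmx_gt_eq0 i (v : 'rV_(size (monos r i))) :
  v *m catmx_gt dg c i = 0 <-> forall j, annihilator (rpoly v * 'X_j).
Proof.
have vXj_homog j : rpoly v * 'X_j \is i.+1.-homog.
  by rewrite -addn1 dhomogM ?rpoly_homog // dhomogX /= mdeg1.
rewrite mul_colmx_eq0; split=> [v0 j|vj [l m]].
  rewrite -(prowK (vXj_homog j)); apply/annihilator_homog/mul_catmx_eq0 => l m ilm.
  rewrite prowK // -mulrA -mpolyXD act_rpoly; last by rewrite mdegD mdeg1 addnA addn1.
  apply: (v0 (l, U_(j) + m)%MM).
  by rewrite mem_cols_gt mdegD mdeg1 /= addnA addn1 ilm eqxx -ilm leq_addr.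
rewrite mem_cols_gt /= => /andP [lt /eqP ilm].
have /existsP [j mj] : [exists j, m j != 0%N].
  apply: contraTT lt => /existsPn m0; rewrite -ilm.
  suff /eqP -> : m == 0%MM by rewrite mdeg0 addn0 ltnn.
  by apply/eqP/mnmP => j; rewrite mnm0E; apply/eqP/negPn/m0.
have mE : m = (U_(j) + (m - U_(j)))%MM.
  rewrite addmC submK //; apply/mnm_lepP => j'; rewrite mnm1E.
  by case: eqP => // <-; rewrite lt0n.
rewrite -(act_rpoly _ _ ilm) mE mpolyXD mulrA.
by have /annihilatorP := vj j; apply.
Qed.

(** The socle in degree [i] is the kernel of [catmx_gt] modulo the smaller kernel of [catmx]. *)
Lemma rank_kermx_gt_catmx i :
  \rank (kermx (catmx_gt dg c i) *m catmx dg c i) =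
  (\rank (catmx dg c i) - \rank (catmx_gt dg c i))%N.
Proof.
have sub : (kermx (catmx dg c i) <= kermx (catmx_gt dg c i))%MS.
  apply/sub_kermxP/row_matrixP => x; rewrite row_mul row0.
  apply/mul_colmx_eq0 => lm; rewrite mem_cols_gt -mem_cols => /andP [_].
  have /mul_colmx_eq0 : row x (kermx (catmx dg c i)) *m catmx dg c i = 0.
    exact/sub_kermxP/row_sub.
  by apply.
have := mxrank_mul_ker (kermx (catmx_gt dg c i)) (catmx dg c i).
rewrite (capmx_idPr sub) !mxrank_ker => rkE.
have := mxrankS sub; rewrite !mxrank_ker.
have := rank_leq_row (catmx dg c i); have := rank_leq_row (catmx_gt dg c i).
lia.
Qed.

(** Macaulay duality from functionals to algebras: the rank jumps become the socle dimensions, and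
    full rank in degree 1 keeps linear forms out of the ideal. *)
Lemma annihilator_data (e : nat) (t : e.+1.-tuple nat) :
  (forall l, dg l <= e)%N ->
  (forall i, (i <= e)%N ->
     \rank (catmx dg c i) = (\rank (catmx_gt dg c i) + nth 0%N t i)%N) ->
  (0 < nth 0%N t e)%N ->
  \rank (catmx dg c 1) = size (monos r 1) ->
  exists I : idealr {mpoly k[r]}, has_data I t /\
    forall i, has_dim (@component k r I i) (\rank (catmx dg c i)).
Proof.
move=> dg_e rkE te rk1.
(* A generator of degree exactly [e] with a nonzero value makes the ideal proper and degree [e] of
   the quotient nonzero. *)
have [l [m [md cm]]] : exists l m, mdeg m = e /\ (dg l = e /\ c l m != 0).
  have : catmx dg c e != 0.
    by rewrite -mxrank_eq0 rkE //; lia.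
  move=> Ke; have /existsP [x /existsP [y]] : [exists x, exists y, catmx dg c e x y != 0].
    apply: contraNT Ke => /existsPn K0; apply/eqP/matrixP => x y; rewrite [RHS]mxE.
    by have /existsPn /(_ y) /negPn /eqP := K0 x.
  rewrite mxE; set lm := tnth _ _ => cl.
  have : lm \in cols r dg e by rewrite mem_tnth.
  rewrite mem_cols => /eqP elm.
  exists lm.1, (mon x + lm.2)%MM.
  have e_l : dg lm.1 = e by apply/eqP; rewrite eqn_leq dg_e -elm leq_addr.
  by rewrite mdegD mdeg_mon elm e_l.
have cl : exists l m, mdeg m = dg l /\ c l m != 0.
  by exists l, m; case: cm => ->.
pose I : idealr {mpoly k[r]} :=
  HB.pack annihilator (isIdealr.Build _ annihilator (annihilator_closed cl)).
have IE i v : @rpoly k r i v \in I <-> v *m catmx dg c i = 0.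
  exact: annihilator_homog.
exists I; split; last by move=> i; apply: has_dim_component.
split; first split.
- by move=> f d; apply: pihomog_annihilator.
- move=> f f1; rewrite -(prowK f1) => /IE /eqP.
  rewrite -(prowK f1); rewrite mulmx_free_eq0; last by rewrite /row_free rk1.
  by move=> /eqP ->; rewrite rpoly0.
- split=> [|d a ed [f fd ->]].
    exists (\pi_({ideal_quot I}) 'X_[m]).
      by exists 'X_[m] => //; rewrite dhomogX /= md.
    apply/eqP => /pi_eq0 /annihilatorP /(_ l 1).
    rewrite mulr1 actX md; case: cm => -> cm; rewrite eqxx => c0.
    by rewrite c0 eqxx in cm.
  apply/pi_eq0; rewrite -(prowK fd); apply/IE/mul_catmx_eq0 => l' m' lm.
  by have := dg_e l'; rewrite -lm leqNgt (leq_trans ed) ?leq_addr.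
move=> i ie; have -> : nth 0%N t i = \rank (kermx (catmx_gt dg c i) *m catmx dg c i).
  by rewrite rank_kermx_gt_catmx rkE // addKn.
apply: has_dim_socle => // v.
apply: iff_trans (mul_catmx_gt_eq0 v); exact: iff_sym (rwP sub_kermxP).
Qed.

End Annihilator.

(** * The inverse system of an algebra *)

(** One index for each element of a socle basis, tagged by its degree. *)
Definition generators (e : nat) (t : e.+1.-tuple nat) : finType :=
  {i : 'I_e.+1 & 'I_(nth 0%N t i)}.

Definition gendeg (e : nat) (t : e.+1.-tuple nat) (l : generators t) : nat := tag l.

Lemma gendeg_leq (e : nat) (t : e.+1.-tuple nat) (l : generators t) : (gendeg l <= e)%N.
Proof. exact: (leq_ord (tag l)). Qed.

Section InverseSystem.
Local Open Scope quotient_scope.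
Variables (k : fieldType) (r : nat) (I : idealr {mpoly k[r]}).
Local Notation A := {ideal_quot I}.

Lemma exists_coordinates i n (b : 'I_n -> A) :
  (forall j, component i (b j)) ->
  (forall a, component i a -> exists! c : {ffun 'I_n -> k}, a = \sum_j c j *: b j) ->
  exists C : 'M_(size (monos r i), n), forall v, \pi_A (rpoly v) = lincomb b (v *m C).
Proof.
move=> bA b_basis.
have Xi (x : 'I_(size (monos r i))) : @component k r I i (\pi_A 'X_[mon x]).
  by exists 'X_[mon x] => //; rewrite dhomogX /= mdeg_mon.
have [c cE] := fin_all_exists (fun x => b_basis _ (Xi x)).
exists (\matrix_(x, j) c x j) => v; rewrite pi_rpoly lincombM.
apply: eq_bigr => x _; congr (_ *: _); rewrite (proj1 (cE x)).
by apply: eq_bigr => j _; rewrite !mxE.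
Qed.

Lemma lincomb_inj_basis (V : lmodType k) (S : V -> Prop) n (b : 'I_n -> V) :
  (forall a, S a -> exists! c : {ffun 'I_n -> k}, a = \sum_j c j *: b j) ->
  forall v w, S (lincomb b v) -> lincomb b v = lincomb b w -> v = w.
Proof.
move=> b_basis v w Sv vw; have [c [_ c_uniq]] := b_basis _ Sv.
have vE : lincomb b v = \sum_j [ffun j => v 0 j] j *: b j.
  by apply: eq_bigr => j _; rewrite ffunE.
have wE : lincomb b v = \sum_j [ffun j => w 0 j] j *: b j.
  by rewrite vw; apply: eq_bigr => j _; rewrite ffunE.
have /ffunP vwE := etrans (esym (c_uniq _ vE)) (c_uniq _ wE).
by apply/rowP => j; have := vwE j; rewrite !ffunE.
Qed.

Lemma component_lincomb i n (b : 'I_n -> A) v :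
  (forall j, component i (b j)) -> component i (lincomb b v).
Proof.
move=> bA; have [f fP] := fin_all_exists2 bA.
move=> fE; exists (\sum_j v 0 j *: f j).
  by apply: rpred_sum => j _; apply: rpredZ.
by rewrite /lincomb raddf_sum; apply: eq_bigr => j _; rewrite fE -pi_scale.
Qed.

(** The functionals read coordinates in a socle basis, extended to the whole component; they vanish
    on [I] and separate the socle. *)
Lemma socle_functionals i n s : has_dim (@component k r I i) n ->
  has_dim (fun a => component i a /\ @socle k r I a) s ->
  exists phi : 'I_s -> 'X_{1..r} -> k,
    (forall f y, f \is i.-homog -> f \in I -> act i (phi y) f = 0) /\
    (forall f, f \is i.-homog -> (forall j, f * 'X_j \in I) ->
       (forall y, act i (phi y) f = 0) -> f \in I).
Proof.
move=> [b bA b_basis] [u uS u_basis].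
have [C CE] := exists_coordinates bA b_basis.
have uA y : component i (u y) by case: (uS y).
have uP y : exists v : 'rV_(size (monos r i)), u y = \pi_A (rpoly v).
  by apply/componentP.
have [w wE] := fin_all_exists uP.
pose B := \matrix_y (w y *m C).
have BE z : lincomb u z = lincomb b (z *m B).
  rewrite lincombM; apply: eq_bigr => y _; congr (_ *: _).
  by rewrite wE CE rowK.
have B_free : row_free B.
  apply/inj_row_free => z zB.
  have z0 : lincomb u z = 0 by rewrite BE zB /lincomb big1 // => j _; rewrite mxE scale0r.
  apply: (lincomb_inj_basis u_basis).
    rewrite z0; split; first by exists 0; rewrite ?rpred0 ?raddf0.
    by move=> a _; rewrite mul0r.
  by rewrite z0 /lincomb big1 // => j _; rewrite mxE scale0r.
(* [pinvmx B] is a right inverse of [B], which extends the socle coordinates to the whole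
   component. *)
pose D := C *m pinvmx B.
pose phi y m := \sum_x D x y *+ (mon x == m).
have phiE (v : 'rV_(size (monos r i))) y : act i (phi y) (rpoly v) = (v *m D) 0 y.
  rewrite -[rpoly v]mulr1 -mpolyX0 act_rpoly ?mdeg0 ?addn0 // mxE.
  apply: eq_bigr => x _; congr (_ * _); rewrite addm0 /phi (bigD1 x) //= eqxx.
  by rewrite big1 ?addr0 // => x' x'x; rewrite (inj_eq (@mon_inj r i)) (negPf x'x).
have CI v : rpoly v \in I -> v *m C = 0.
  move=> /pi_eq0; rewrite CE => v0; apply: (lincomb_inj_basis b_basis).
    exact: component_lincomb.
  by rewrite v0 /lincomb big1 // => j _; rewrite mxE scale0r.
exists phi; split=> [f y fi fI|f fi fX fphi].
  move: fI; rewrite -(prowK fi) => /CI v0.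
  by rewrite phiE mulmxA v0 mul0mx mxE.
have [z [zE _]] : exists! z : {ffun 'I_s -> k}, \pi_A f = \sum_y z y *: u y.
  by apply: u_basis; split; [exists f|apply/socle_pi].
have fz : \pi_A f = lincomb u (\row_y z y).
  by rewrite zE; apply: eq_bigr => y _; rewrite mxE.
have fC : prow i f *m C = \row_y z y *m B.
  apply: (lincomb_inj_basis b_basis); first exact: component_lincomb.
  by rewrite -CE prowK // -BE fz.
have : \row_y z y = 0.
  rewrite -[LHS]mulmx1 -(mulmxVp B_free) mulmxA -fC -mulmxA.
  by apply/rowP => y; rewrite [RHS]mxE -/D -phiE prowK // fphi.
move=> z0; apply/pi_eq0; rewrite fz z0 /lincomb big1 // => y _.
by rewrite mxE scale0r.
Qed.

(** Macaulay duality from algebras to functionals: a form is in the ideal iff its multiples by the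
    variables are and the socle functionals of its degree vanish on it. *)
Lemma exists_inverse_system (e : nat) (t h : e.+1.-tuple nat) :
  has_data I t -> hvector I h ->
  exists c : generators t -> 'X_{1..r} -> k,
    forall i (v : 'rV_(size (monos r i))),
      rpoly v \in I <-> v *m catmx (@gendeg e t) c i = 0.
Proof.
move=> [[_ _ [_ I_gt]] t_socle] h_dim.
have H (i : 'I_e.+1) : exists phi : 'I_(nth 0%N t i) -> 'X_{1..r} -> k,
    (forall f y, f \is i.-homog -> f \in I -> act i (phi y) f = 0) /\
    (forall f, f \is i.-homog -> (forall j, f * 'X_j \in I) ->
       (forall y, act i (phi y) f = 0) -> f \in I).
  have ie : (i <= e)%N := leq_ord i.
  exact: socle_functionals (h_dim i ie) (t_socle i ie).
have [phi phiP] := fin_all_exists H.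
pose c (l : generators t) := phi (tag l) (tagged l).
exists c => i v; rewrite mul_catmx_eq0; split=> [vI l m ilm|].
  case: (phiP (tag l)) => + _; apply.
    rewrite -[in X in _ \is X.-homog]/(gendeg l) -ilm dhomogM ?rpoly_homog //.
    by rewrite dhomogX.
  by rewrite mulrC idealMr.
(* Descending induction on the degree, starting above [e], where every form lies in [I]. *)
have [n ni] := ubnP (e.+1 - i)%N; elim: n => // n IHn in i ni v *.
move=> v0; have [ei|ie] := ltnP e i.
  by apply/pi_eq0/(I_gt i) => //; exists (rpoly v); rewrite ?rpoly_homog.
have [_] := phiP (Ordinal (ie : (i < e.+1)%N)); apply=> [|j|y].
- exact: rpoly_homog.
- have fj : rpoly v * 'X_j \is i.+1.-homog.
    by rewrite -addn1 dhomogM ?rpoly_homog // dhomogX /= mdeg1.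
  rewrite -(prowK fj); apply: IHn => [|l m ilm]; first by lia.
  by rewrite prowK // -mulrA -mpolyXD; apply: v0; rewrite mdegD mdeg1 addnA addn1.
have := v0 (Tagged (fun i : 'I_e.+1 => 'I_(nth 0%N t i)) y) 0%MM.
by rewrite mpolyX0 mulr1 mdeg0 addn0; apply.
Qed.

End InverseSystem.

(** * Growth of ideals *)

Section Growth.
Variables (k : fieldType) (r : nat).

(** The next vector is taken in [U] with zero coefficients at the leading monomials already used;
    fewer than [\rank U] conditions leave a nonzero solution. *)
Lemma exists_distinct_mleads (d l s : nat) (U : 'M[k]_(l, size (monos r d))) :
  (s <= \rank U)%N ->
  exists vs : seq 'rV[k]_(size (monos r d)),
    [/\ size vs = s, forall v, v \in vs -> (v <= U)%MS /\ v != 0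
      & uniq [seq mlead (rpoly v) | v <- vs]].
Proof.
elim: s => [|s IHs] sU; first by exists [::].
have [vs [vs_s vsU vs_uniq]] := IHs (ltnW sU).
pose S := \matrix_(x < size (monos r d), y < s)
  ((mon x == mlead (rpoly (nth 0 vs y)))%:R : k).
pose v := nz_row (U :&: kermx S)%MS.
have v0 : v != 0.
  rewrite nz_row_eq0 -mxrank_eq0 -lt0n -(ltn_add2l (\rank (U *m S))) addn0.
  by rewrite mxrank_mul_ker (leq_ltn_trans (rank_leq_col _)).
have vUS : (v <= U :&: kermx S)%MS by exact: nz_row_sub.
exists (v :: vs); split => [|w|] /=; first by rewrite vs_s.
  rewrite inE => /predU1P [->|/vsU //].
  by split=> //; rewrite (submx_trans vUS) ?capmxSl.
rewrite vs_uniq andbT; apply/mapP => -[w wvs vw].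
have /sub_kermxP /rowP vS := submx_trans vUS (capmxSr U (kermx S)).
have wi : (index w vs < s)%N by rewrite -vs_s index_mem.
have := vS (Ordinal wi); rewrite mxE [RHS]mxE.
have w0 : rpoly w != 0 by rewrite rpoly_eq0; case: (vsU _ wvs).
have /(@monP r) [x xE] : mdeg (mlead (rpoly w)) = d.
  exact: (dhomog_mf (rpoly_homog w) (mlead_supp w0)).
rewrite (bigD1 x) //= big1 => [|x' x'x]; rewrite mxE /= nth_index // xE.
  by rewrite eqxx mulr1 addr0 -mcoeff_rpoly -xE -vw; apply/eqP; rewrite mleadc_eq0 rpoly_eq0.
by rewrite (inj_eq (@mon_inj r d)) (negPf x'x) mulr0.
Qed.

(** Each [m'], being distinct from [m] and of the same degree, has a variable with a larger exponent
    than in [m]; [Z] collects one such variable per [m'], and [u] cannot make up for it. *)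
Lemma exists_avoiding_set (p : nat) (m : 'X_{1..r}) (ms : seq 'X_{1..r}) :
  mdeg m = p -> m \notin ms -> {in ms, forall m', mdeg m' = p} ->
  exists2 Z : {set 'I_r}, (#|Z| <= size ms)%N &
    forall u : 'X_{1..r}, (forall i, i \in Z -> u i = 0%N) ->
      {in ms, forall m', ~~ (m' <= m + u)%MM}.
Proof.
move=> mp; elim: ms => [|m' ms IH]; first by exists set0; rewrite ?cards0.
rewrite inE negb_or => /andP [mm' /IH {}IH] ms_p.
have [|Z Zs Zu] := IH; first by move=> m'' m''s; apply: ms_p; rewrite inE m''s orbT.
have /existsP [j mj] : [exists j, (m j < m' j)%N].
  apply: contraNT mm' => /existsPn le; have m'm : (m' <= m)%MM.
    by apply/mnm_lepP => j; rewrite leqNgt.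
  have : mdeg (m - m') == 0%N.
    have := congr1 (@mdeg r) (submK m'm); rewrite mdegD mp (ms_p m') ?inE ?eqxx //.
    by move=> e; apply/eqP; lia.
  by rewrite mdeg_eq0 => /eqP m0; rewrite -(submK m'm) m0 add0m.
exists (j |: Z) => [|u u0 m'']; first by rewrite cardsU1 /= -add1n leq_add ?leq_b1.
rewrite inE => /predU1P [->|]; last by apply: Zu => i iZ; rewrite u0 // inE iZ orbT.
apply/negP => /mnm_lepP /(_ j).
by rewrite mnmDE u0 ?inE ?eqxx // addn0 leqNgt mj.
Qed.

(* A multiple of a later monomial that avoids one well-chosen variable for
   each earlier monomial is not a multiple of any of these. *)
Lemma exists_many_multiples (p a : nat) (ms : seq 'X_{1..r}) :
  uniq ms -> {in ms, forall m, mdeg m = p} -> (size ms <= r)%N ->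
  exists T : seq ('X_{1..r} * 'X_{1..r}),
    [/\ forall mu, mu \in T -> mu.1 \in ms /\ mdeg mu.2 = a,
        uniq [seq (mu.1 + mu.2)%MM | mu <- T]
      & (\sum_(j < size ms) numN (r - j) a <= size T)%N].
Proof.
elim/last_ind: ms => [|ms m IH]; first by exists [::]; rewrite big_ord0.
rewrite rcons_uniq size_rcons => /andP [m_ms ms_uniq] ms_p ms_r.
have [||T [TP T_uniq T_size]] := IH ms_uniq; last 1 first.
- have mp : mdeg m = p by rewrite ms_p // mem_rcons inE eqxx.
  have [|Z Zs Zu] := exists_avoiding_set mp m_ms.
    by move=> m' m's; rewrite ms_p // mem_rcons inE m's orbT.
  have uZ u i : u \in monos_on (~: Z) a -> i \in Z -> u i = 0%N.
    rewrite mem_monos_on => /andP [_ /forallP /(_ i)].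
    by rewrite inE implybNN => /implyP uZ /uZ /eqP.
  exists (T ++ [seq (m, u) | u <- monos_on (~: Z) a]); split.
  + move=> mu; rewrite mem_cat => /orP [/TP [mu1 mu2]|/mapP [u + ->]].
      by rewrite mem_rcons inE mu1 orbT.
    by rewrite mem_monos_on mem_rcons inE eqxx => /andP [/eqP].
  + rewrite map_cat cat_uniq T_uniq -map_comp map_inj_uniq ?monos_on_uniq ?andbT /=.
      apply/hasPn => _ /mapP [u uW ->] /=; apply/mapP => -[mu /TP [mu1 _] mE].
      have := Zu u (fun i => uZ u i uW) _ mu1.
      by rewrite mE lem_addr.
    by move=> u u' /= /addmI.
  rewrite size_cat size_map big_ord_recr /= leq_add //.
  have := cardsC Z; rewrite card_ord => Zc.
  by rewrite size_monos_on ?leq_numN_l //; lia.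
- by move=> m' m's; rewrite ms_p // mem_rcons inE m's orbT.
exact: ltnW.
Qed.

(** Forms in the kernel of [K] with distinct leading monomials have multiples in the kernel of [K'];
    those selected by [exists_many_multiples] again have distinct leading monomials, hence are
    independent. *)
Lemma rank_multiples_le (p a s q q' : nat) (K : 'M[k]_(size (monos r p), q))
  (K' : 'M[k]_(size (monos r (p + a)), q')) :
  (forall v m, v *m K = 0 -> mdeg m = a ->
     prow (p + a) (rpoly v * 'X_[m]) *m K' = 0) ->
  (s <= r)%N -> (\rank K + s <= size (monos r p))%N ->
  (\rank K' + \sum_(j < s) numN (r - j) a <= size (monos r (p + a)))%N.
Proof.
move=> KK' sr rkK.
have [|vs [vs_s vsK vs_uniq]] := @exists_distinct_mleads p _ s (kermx K).
  by rewrite mxrank_ker; lia.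
set ms := [seq mlead (rpoly v) | v <- vs].
have ms_s : size ms = s by rewrite size_map.
pose F m := nth 0 vs (index m ms).
have FP m : m \in ms -> F m \in vs /\ mlead (rpoly (F m)) = m.
  move=> m_ms; have lt : (index m ms < size vs)%N by rewrite vs_s -ms_s index_mem.
  split; first exact: mem_nth.
  have := @nth_map _ 0 _ 0%MM (fun v => mlead (rpoly v)) _ _ lt.
  by rewrite nth_index.
have Fn0 m : m \in ms -> rpoly (F m) != 0.
  by move=> /FP [/vsK [_ + _]]; rewrite rpoly_eq0.
have ms_p : {in ms, forall m, mdeg m = p}.
  move=> m m_ms; have [_ {1}<-] := FP _ m_ms.
  exact: (dhomog_mf (rpoly_homog _) (mlead_supp (Fn0 _ m_ms))).
have [|T [TP T_uniq]] := @exists_many_multiples p a ms vs_uniq ms_p.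
  by rewrite ms_s.
rewrite ms_s => T_size.
pose g (y : 'I_(size T)) := let mu := tnth (in_tuple T) y in rpoly (F mu.1) * 'X_[mu.2].
have TPy (y : 'I_(size T)) := TP _ (mem_tnth y (in_tuple T)).
have g_homog y : g y \is (p + a).-homog.
  by rewrite dhomogM ?rpoly_homog // dhomogX /= (TPy y).2.
have g_lead y : mlead (g y) = let mu := tnth (in_tuple T) y in (mu.1 + mu.2)%MM.
  have [mu1 _] := TPy y.
  rewrite mleadM ?mleadXm ?Fn0 ?(FP _ mu1).2 //.
  by rewrite -msupp_eq0 msuppX.
have g_inj : injective (fun y => mlead (g y)).
  move=> y y'; rewrite !g_lead => yy'; apply/val_inj => /=; apply/eqP.
  rewrite -(@nth_uniq _ 0%MM _ _ _ _ _ T_uniq) ?size_map //.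
  rewrite !(nth_map (0%MM, 0%MM)) //.
  by move: yy'; rewrite !(tnth_nth (0%MM, 0%MM)) /= => ->.
have gn0 y : (g y)@_(mlead (g y)) != 0.
  rewrite mleadc_eq0 mulf_neq0 ?Fn0 ?(TPy y).1 //.
  by rewrite -msupp_eq0 msuppX.
pose G := \matrix_y prow (p + a) (g y).
have G_free : row_free G.
  apply/inj_row_free => w wG.
  (* The coefficients at the leading monomials form a triangular matrix for the monomial order. *)
  have : row_free (\matrix_(y, z) (g y)@_(mlead (g z))).
    apply: (@row_free_triangular _ _ _ _ (fun y => mlead (g y))) => [y|y z]; rewrite mxE //.
    move=> gyz yz; rewrite lt_neqAle (inj_eq g_inj) eq_sym yz.
    by apply: msupp_le_mlead; rewrite mcoeff_msupp.
  move=> M_free; apply/eqP; rewrite -(mulmx_free_eq0 w M_free).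
  apply/eqP/rowP => z; rewrite mxE [RHS]mxE.
  have /(@monP r) [x xE] : mdeg (mlead (g z)) = (p + a)%N.
    by apply: (dhomog_mf (g_homog z)); rewrite mcoeff_msupp.
  have /rowP /(_ x) := wG; rewrite mxE [RHS]mxE => wx; rewrite -[RHS]wx.
  by apply: eq_bigr => y _; rewrite !mxE xE.
have GK : (G <= kermx K')%MS.
  apply/sub_kermxP/row_matrixP => y; rewrite row_mul row0 rowK.
  have [/FP [/vsK [/sub_kermxP FK _] _] mu2] := TPy y.
  exact: KK'.
have := mxrankS GK; rewrite (eqP G_free) mxrank_ker.
have := rank_leq_row K'; lia.
Qed.

Definition hankel (c : 'X_{1..r} -> k) (i j : nat) :
  'M[k]_(size (monos r i), size (monos r j)) :=
  \matrix_(x, y) c (mon x + mon y)%MM.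

Lemma rank_hankelC c i j : \rank (hankel c i j) = \rank (hankel c j i).
Proof.
rewrite -mxrank_tr; congr (\rank _); apply/matrixP => x y.
by rewrite !mxE addmC.
Qed.

Lemma mul_hankel_eq0 c i j (v : 'rV_(size (monos r i))) :
  v *m hankel c i j = 0 <->
  forall m, mdeg m = j -> act (i + j) c (rpoly v * 'X_[m]) = 0.
Proof.
split=> [/rowP v0 m /(@monP r) [y ->]|v0].
  rewrite act_rpoly ?mdeg_mon //; have := v0 y; rewrite mxE [RHS]mxE => vy.
  by rewrite -[RHS]vy; apply: eq_bigr => x _; rewrite mxE.
apply/rowP => y; rewrite [RHS]mxE -(v0 _ (mdeg_mon y)) act_rpoly ?mdeg_mon // mxE.
by apply: eq_bigr => x _; rewrite mxE.
Qed.

Lemma rank_hankel_growth c p a j s :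
  (s <= r)%N -> (\rank (hankel c p (a + j)) + s <= size (monos r p))%N ->
  (\rank (hankel c (p + a) j) + \sum_(l < s) numN (r - l) a <= size (monos r (p + a)))%N.
Proof.
apply: rank_multiples_le => v m /mul_hankel_eq0 v0 ma.
have fm : rpoly v * 'X_[m] \is (p + a).-homog.
  by rewrite dhomogM ?rpoly_homog // dhomogX /= ma.
apply/mul_hankel_eq0 => m' m'j; rewrite prowK // -mulrA -mpolyXD -addnA.
by apply: v0; rewrite mdegD ma m'j.
Qed.

End Growth.

(** * Evaluation at grid points *)

Section GridPoints.
Variables (k : fieldType) (n : nat).
Hypothesis char0 : [pchar k] =i pred0.
Implicit Types (a b m : 'X_{1..n.+1}) (S Q : seq 'X_{1..n.+1}).

(** An affine grid point in homogeneous coordinates: exponents differing only in the last variable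
    give the same point. *)
Definition gridpt b : 'I_n.+1 -> k := fun j => if j == ord_max then 1 else (b j)%:R.

(* Homogenized Newton interpolation basis of the integer grid. *)
Definition newton a : {mpoly k[n.+1]} :=
  \prod_j (if j == ord_max then 'X_ord_max ^+ a ord_max
           else \prod_(c < a j) ('X_j - c%:R *: 'X_ord_max)).

Lemma dhomog_bigprod (I : Type) (s : seq I) (d : I -> nat) (F : I -> {mpoly k[n.+1]}) :
  (forall i, F i \is (d i).-homog) ->
  \prod_(i <- s) F i \is (\sum_(i <- s) d i)%N.-homog.
Proof.
move=> Fd; elim/big_ind2: _ => // [|f d1 g d2 fd gd]; first exact: dhomog1.
exact: dhomogM.
Qed.

Lemma newton_homog a : newton a \is (mdeg a).-homog.
Proof.
rewrite mdegE; apply: dhomog_bigprod => j.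
have X_homog i : ('X_i : {mpoly k[n.+1]}) \is 1.-homog by rewrite dhomogX /= mdeg1.
case: eqP => [->|_].
  by rewrite -[X in X.-homog]mul1n; apply: dhomogMn.
rewrite -[X in X.-homog]card_ord -sum1_card.
by apply: dhomog_bigprod => c; rewrite rpredB ?rpredZ.
Qed.

(** If [b j < a j], the factor with [c = b j] vanishes; otherwise all factors are positive integers,
    nonzero in characteristic zero. *)
Lemma newton_neq0 a b :
  reflect (forall j, j != ord_max -> a j <= b j)%N ((newton a).@[gridpt b] != 0).
Proof.
have -> : (newton a).@[gridpt b] =
    \prod_j (if j == ord_max then 1 else \prod_(c < a j) ((b j)%:R - (val c)%:R) : k).
  rewrite /newton rmorph_prod; apply: eq_bigr => j _.
  case: eqP => [_|/eqP j_max]; first by rewrite rmorphXn /= mevalXU /gridpt eqxx expr1n.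
  rewrite rmorph_prod; apply: eq_bigr => c _.
  by rewrite /= mevalB mevalZ !mevalXU /gridpt (negPf j_max) eqxx mulr1.
apply: (iffP idP) => [/prodf_neq0 ab j j_max|ab]; last apply/prodf_neq0 => j _.
  rewrite leqNgt; apply/negP => lt; have := ab j isT.
  rewrite (negPf j_max) => /prodf_neq0 /(_ (Ordinal lt) isT).
  by rewrite subrr eqxx.
case: (boolP (j == ord_max)) => [_|/ab le]; first exact: oner_neq0.
apply/prodf_neq0 => c _; rewrite subr_eq0 natr_inj_char0 //.
by rewrite gtn_eqF // (leq_trans (ltn_ord c)).
Qed.

Definition evalmx i Q : 'M[k]_(size (monos n.+1 i), size Q) :=
  \matrix_(x, y) 'X_[mon x].@[gridpt (tnth (in_tuple Q) y)].

Lemma mul_prow_evalmx i Q (f : {mpoly k[n.+1]}) y : f \is i.-homog ->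
  (prow i f *m evalmx i Q) 0 y = f.@[gridpt (tnth (in_tuple Q) y)].
Proof.
move=> f_homog; rewrite -[in RHS](prowK f_homog) /rpoly /lincomb raddf_sum mxE.
by apply: eq_bigr => x _; rewrite /= mevalZ !mxE.
Qed.

Definition newtonmx i S : 'M[k]_(size S, size (monos n.+1 i)) :=
  \matrix_y prow i (newton (tnth (in_tuple S) y)).

(** Newton polynomials evaluated at their own grid points form a triangular matrix; [Q] contains
    these points up to the ignored last exponent. *)
Lemma newton_evalmx_free i S Q : uniq S -> {subset S <= monos n.+1 i} ->
  {in S, forall a, exists2 b, b \in Q & forall j, j != ord_max -> a j = b j} ->
  row_free (newtonmx i S *m evalmx i Q).
Proof.
move=> S_uniq S_i SQ.
have Si (y : 'I_(size S)) : mdeg (tnth (in_tuple S) y) = i.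
  by apply/eqP; rewrite -mem_monos; apply: S_i; exact: (mem_tnth y (in_tuple S)).
have free : row_free (\matrix_(y < size S, z < size S)
    (newton (tnth (in_tuple S) y)).@[gridpt (tnth (in_tuple S) z)]).
  (* All degrees agree, so an exponent dominated off the last variable has the larger last exponent,
     which serves as key. *)
  apply: (@row_free_triangular _ _ _ _ (fun y => tnth (in_tuple S) y ord_max)).
    by move=> y; rewrite mxE; apply/newton_neq0.
  move=> y z; rewrite mxE => /newton_neq0 yz y_z.
  rewrite ltEnat /= ltnNge; apply: contra y_z => le.
  suff /eqP : tnth (in_tuple S) y = tnth (in_tuple S) z.
    by rewrite !(tnth_nth 0%MM) nth_uniq.
  have le_all j : (tnth (in_tuple S) y j <= tnth (in_tuple S) z j)%N.
    by case: (eqVneq j ord_max) => [->|/yz].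
  set a := tnth _ y in le_all *; set b := tnth _ z in le_all *.
  have ab : (a <= b)%MM by apply/mnm_lepP.
  have : mdeg (b - a) == 0%N.
    by have := congr1 (@mdeg _) (submK ab); rewrite mdegD !Si => e; apply/eqP; lia.
  by rewrite mdeg_eq0 => /eqP ba0; rewrite -(submK ab) ba0 add0m.
apply/inj_row_free => w w0; apply/eqP; rewrite -(mulmx_free_eq0 w free).
apply/eqP/rowP => z; rewrite mxE [RHS]mxE.
have [b bQ zb] := SQ _ (mem_tnth z (in_tuple S)).
have /tnthP [z' z'E] : b \in in_tuple Q by [].
have /rowP /(_ z') := w0; rewrite mxE [RHS]mxE => wz; rewrite -[RHS]wz.
apply: eq_bigr => y _; rewrite mxE; congr (_ * _).
have := @mul_prow_evalmx i Q (newton (tnth (in_tuple S) y)) z'.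
rewrite -{1}(Si y) newton_homog => /(_ isT).
rewrite -z'E => E; transitivity ((newton (tnth (in_tuple S) y)).@[gridpt b]).
  by apply: meval_eq => j; rewrite /gridpt; case: eqP => // /eqP /zb ->.
by rewrite -E !mxE; apply: eq_bigr => x _; rewrite !mxE.
Qed.

Section OrderIdeal.
Variables (P : pred 'X_{1..n.+1}) (t : nat).
Hypothesis P_down : forall a b, P b -> (forall j, j != ord_max -> (a j <= b j)%N) -> P a.

Definition std d := [seq m : 'X_{1..n.+1} <- monos n.+1 d | P m].

Lemma mem_std d m : (m \in std d) = P m && (mdeg m == d).
Proof. by rewrite mem_filter mem_monos. Qed.

Lemma std_uniq d : uniq (std d).
Proof. by rewrite filter_uniq ?monos_uniq. Qed.

(** Multiplication by a power of the last variable changes the degree without moving the grid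
    point. *)
Definition raise d m : 'X_{1..n.+1} := (m + U_(ord_max) *+ d)%MM.

Lemma mdeg_raise d m : mdeg (raise d m) = (mdeg m + d)%N.
Proof. by rewrite mdegD mdegMn mdeg1 mul1n. Qed.

Lemma raiseE d m j : j != ord_max -> raise d m j = m j.
Proof. by move=> j_max; rewrite mnmDE mulmnE mnm1E eq_sym (negPf j_max) addn0. Qed.

Lemma raise_inj d : injective (raise d).
Proof. by move=> m m'; rewrite /raise !(addmC _ (_ *+ _)%MM) => /addmI. Qed.

Lemma P_raise d m : P m -> P (raise d m).
Proof. by move=> Pm; apply: P_down Pm _ => j /raiseE ->. Qed.

(** Newton polynomials of standard monomials give the lower bound; those of nonstandard monomials
    lie in the kernel and give the upper bound. *)
Lemma rank_evalmx_low i : (i <= t)%N -> \rank (evalmx i (std t)) = size (std i).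
Proof.
move=> it; apply/eqP; rewrite eqn_leq; apply/andP; split; last first.
  have /eqP <- : row_free (newtonmx i (std i) *m evalmx i (std t)).
    apply: newton_evalmx_free; first exact: std_uniq.
      by move=> m; rewrite mem_std mem_monos => /andP [].
    move=> m; rewrite mem_std => /andP [Pm /eqP mi].
    exists (raise (t - i) m); last by move=> j /raiseE ->.
    by rewrite mem_std P_raise // mdeg_raise mi subnKC /=.
  exact: mxrankM_maxr.
pose S := [seq m : 'X_{1..n.+1} <- monos n.+1 i | ~~ P m].
have S_i : {subset S <= monos n.+1 i} by move=> m; rewrite mem_filter => /andP [].
have free : row_free (newtonmx i S *m evalmx i S).
  apply: newton_evalmx_free => //; first by rewrite filter_uniq ?monos_uniq.
  by move=> m mS; exists m.
have Srank : (size S <= \rank (newtonmx i S))%N.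
  by rewrite -{1}(eqP free) mxrankM_maxl.
(* By [P_down], a Newton polynomial of a nonstandard monomial vanishes at every standard point. *)
have Sker : (newtonmx i S <= kermx (evalmx i (std t)))%MS.
  apply/sub_kermxP/row_matrixP => y; rewrite row_mul row0 rowK.
  have := mem_tnth y (in_tuple S); set a := tnth _ y.
  rewrite mem_filter mem_monos => /andP [nPa /eqP ai].
  apply/rowP => z; rewrite [RHS]mxE mul_prow_evalmx; last by rewrite -ai newton_homog.
  apply/eqP; apply: contraNT nPa => /newton_neq0 le.
  apply: P_down le; have := mem_tnth z (in_tuple (std t)).
  by rewrite mem_std => /andP [].
have := mxrankS Sker; rewrite mxrank_ker.
have : (size (std i) + size S = size (monos n.+1 i))%N.
  by rewrite !size_filter (count_predC P).
have := rank_leq_row (evalmx i (std t)); move: Srank.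
by lia.
Qed.

(** Raising the standard monomials of degree [t] to degree [i] keeps their points, so all columns
    are independent. *)
Lemma rank_evalmx_high i : (t <= i)%N -> \rank (evalmx i (std t)) = size (std t).
Proof.
move=> ti; apply/eqP; rewrite eqn_leq rank_leq_col.
pose S := [seq raise (i - t) m | m <- std t].
have /eqP : row_free (newtonmx i S *m evalmx i (std t)).
  apply: newton_evalmx_free.
  - by rewrite map_inj_uniq ?std_uniq //; apply: raise_inj.
  - move=> _ /mapP [m + ->]; rewrite mem_std mem_monos => /andP [_ /eqP mt].
    by rewrite mdeg_raise mt subnKC.
  by move=> _ /mapP [m mt ->]; exists m => // j /raiseE ->.
by rewrite [X in _ = X]size_map /= => {1}<-; exact: mxrankM_maxr.
Qed.

Definition powersum m : k := \sum_(b <- std t) 'X_[m].@[gridpt b].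

(** The Hankel matrix of a sum of evaluations is a product of two evaluation matrices, the right one
    of full rank. *)
Lemma rank_hankel_powersum i j : (i <= t <= j)%N ->
  \rank (hankel powersum i j) = size (std i).
Proof.
move=> /andP [it tj].
have -> : hankel powersum i j = evalmx i (std t) *m (evalmx j (std t))^T.
  apply/matrixP => x y; rewrite !mxE /powersum big_tnth; apply: eq_bigr => z _.
  by rewrite !mxE mpolyXD mevalM.
rewrite mxrankMfree ?rank_evalmx_low //.
by rewrite /row_free mxrank_tr rank_evalmx_high.
Qed.

End OrderIdeal.

End GridPoints.

(** * Generic inverse systems *)

Section Generic.
Variables (k : fieldType) (r : nat) (L : finType) (dg : L -> nat).
Hypothesis char0 : [pchar k] =i pred0.
Implicit Types (c : L -> 'X_{1..r} -> k).

Lemma cols_uniq i : uniq (cols r dg i).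
Proof.
apply: allpairs_uniq_dep => [|l _|[l m] [l' m'] _ _ [-> ->]] //.
  exact: enum_uniq.
by case: ifP => //; rewrite monos_uniq.
Qed.

Lemma catmx_add c c' (t : k) i :
  catmx dg (fun l m => c l m + t * c' l m) i = catmx dg c i + t *: catmx dg c' i.
Proof. by apply/matrixP => x y; rewrite !mxE. Qed.

(* The product of nonzero polynomials read off a left and a right kernel vector
   is nonzero, and moving [c] along one of its monomials raises the rank. *)
Lemma catmx_improvable c i :
  (\rank (catmx dg c i) < minn (size (monos r i)) (size (cols r dg i)))%N ->
  exists c' (u : 'rV_(size (monos r i))) (v : 'cV_(size (cols r dg i))),
    [/\ u *m catmx dg c i = 0, catmx dg c i *m v = 0
      & u *m catmx dg c' i *m v != 0].
Proof.
set A := catmx dg c i; rewrite leq_min => /andP [rk_row rk_col].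
pose u := nz_row (kermx A); pose v := (nz_row (kermx A^T))^T.
have u0 : u != 0 by rewrite nz_row_eq0 -mxrank_eq0 mxrank_ker; lia.
have v0 : v != 0.
  by rewrite trmx_eq0 nz_row_eq0 -mxrank_eq0 mxrank_ker mxrank_tr; lia.
have uA : u *m A = 0 by apply/sub_kermxP/nz_row_sub.
have Av : A *m v = 0.
  apply: trmx_inj; rewrite trmx_mul trmx0 trmxK.
  by apply/sub_kermxP/nz_row_sub.
clearbody u v.
have /existsP [y0 vy0] : [exists y, v y 0 != 0].
  apply: contraNT v0 => /existsPn v0; apply/eqP/colP => y.
  by rewrite [RHS]mxE; apply/eqP/negPn/v0.
pose col y := tnth (in_tuple (cols r dg i)) y.
have col_inj : injective col.
  move=> y y' /eqP; rewrite /col !(tnth_nth (col y0)) nth_uniq ?cols_uniq //.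
  by move=> /eqP yy; apply: val_inj.
pose l := (col y0).1.
pose V : {mpoly k[r]} := \sum_(y | (col y).1 == l) v y 0 *: 'X_[(col y).2].
have V0 : V != 0.
  apply: contraNneq vy0 => /(congr1 (mcoeff (col y0).2)).
  rewrite mcoeff0 raddf_sum /= (bigD1 y0) ?eqxx //= mcoeffZ mcoeffX eqxx mulr1.
  rewrite big1 ?addr0 => [->//|y /andP [/eqP yl y_y0]].
  rewrite mcoeffZ mcoeffX; case: eqP => [yy|]; last by rewrite mulr0.
  case/eqP: y_y0; apply: col_inj.
  by rewrite [col y]surjective_pairing [col y0]surjective_pairing yy yl.
have UV0 : rpoly u * V != 0 by rewrite mulf_neq0 ?rpoly_eq0.
pose m := mlead (rpoly u * V).
pose c' (l' : L) (m' : 'X_{1..r}) : k := ((l' == l) && (m' == m))%:R.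
exists c', u, v; split => //.
have : (rpoly u * V)@_m != 0 by rewrite mleadc_eq0.
suff -> : (rpoly u * V)@_m = (u *m catmx dg c' i *m v) 0 0.
  by apply: contraNneq => ->; rewrite mxE.
rewrite mulr_sumr raddf_sum mxE big_mkcond; apply: eq_bigr => y _ /=.
rewrite mxE; case: eqP => [yl|yl]; last first.
  rewrite big1 ?mul0r // => x _; rewrite mxE /c' -/(col y).
  by case: eqP; rewrite //= mulr0.
rewrite -scalerAr mcoeffZ mulrC; congr (_ * _).
rewrite /rpoly /lincomb mulr_suml raddf_sum; apply: eq_bigr => x _ /=.
by rewrite -scalerAl mcoeffZ -mpolyXD mcoeffX mxE /c' -/(col y) yl eqxx.
Qed.

Lemma exists_generic (e : nat) : exists c, forall i, (i <= e)%N ->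
  \rank (catmx dg c i) = minn (size (monos r i)) (size (cols r dg i)).
Proof.
pose tot c := (\sum_(i < e.+1) \rank (catmx dg c i))%N.
pose bound := (\sum_(i < e.+1) size (monos r i))%N.
have tot_le c : (tot c <= bound)%N.
  by apply: leq_sum => i _; apply: rank_leq_row.
(* Induction on the room left between the total rank and its bound. *)
suff : forall N c, (bound - tot c < N)%N -> exists c, forall i, (i <= e)%N ->
    \rank (catmx dg c i) = minn (size (monos r i)) (size (cols r dg i)).
  by move=> /(_ _ (fun _ _ => 0)); apply; apply: ltnSn.
elim=> // N IHN c; rewrite ltnS => cN.
case: (boolP [forall i : 'I_e.+1, \rank (catmx dg c i) ==
    minn (size (monos r i)) (size (cols r dg i))]) => [/forallP c_max|].
  by exists c => i ie; apply/eqP: (c_max (Ordinal (ie : (i < e.+1)%N))).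
move=> /forallPn [i i_rk].
have lt : (\rank (catmx dg c i) < minn (size (monos r i)) (size (cols r dg i)))%N.
  by rewrite ltn_neqAle i_rk leq_min rank_leq_row rank_leq_col.
have [c' [u [v [uA Av uBv]]]] := catmx_improvable lt.
have [q q0 qP] := rank_perturb_lt uA Av uBv.
have [f f0 fP] := fin_all_exists2 (fun j : 'I_e.+1 => rank_perturb (catmx dg c j) (catmx dg c' j)).
(* A nonroot [t] of this product raises the rank in degree [i] and lowers it in no degree. *)
have qf0 : q * \prod_j f j != 0.
  by rewrite mulf_neq0 //; apply/prodf_neq0 => j _.
have [t] := exists_nonroot char0 qf0.
rewrite hornerM horner_prod mulf_eq0 negb_or => /andP [qt /prodf_neq0 ft].
apply: (IHN (fun l m => c l m + t * c' l m)).
suff : (tot c < tot (fun l m => c l m + t * c' l m)%R)%N.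
  by have := tot_le (fun l m => c l m + t * c' l m)%R; lia.
rewrite /tot (bigD1 i) //= [ltnRHS](bigD1 i) //= -addSn leq_add //.
  by rewrite catmx_add qP.
by apply: leq_sum => j _; rewrite catmx_add fP ?ft.
Qed.

End Generic.

(** * Counting standard monomials *)

(* The largest value in degree [i] of the h-vector of [R / J] when [J] has [s]
   forms of degree [p]. *)
Definition growth_bound (r p s i : nat) : nat :=
  if (i < p)%N then numN r i else (numN r i - \sum_(l < s) numN (r - l) (i - p))%N.

Section LexStandard.
Variables (n p s : nat).
Hypotheses (p_gt0 : (0 < p)%N) (sn : (s <= n)%N) (s_gt0 : (0 < s)%N).

(* Monomials outside the lex-segment ideal [x_0^(p-1) * (x_0, ..., x_(s-1))]. *)
Definition lexstd (m : 'X_{1..n.+1}) : bool :=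
  (m ord0 < p.-1)%N ||
  (m ord0 == p.-1) && [forall j : 'I_n.+1, (0 < j < s)%N ==> (m j == 0%N)].

(** As [s <= n], the last variable is not among the first [s], so [lexstd] does not see its
    exponent. *)
Lemma lexstd_down (a b : 'X_{1..n.+1}) : lexstd b ->
  (forall j, j != ord_max -> (a j <= b j)%N) -> lexstd a.
Proof.
have neq_max (j : 'I_n.+1) : (j < s)%N -> j != ord_max.
  by move=> js; rewrite -val_eqE /= ltn_eqF // (leq_trans js).
move=> b_std ab; have ab0 := ab _ (neq_max ord0 s_gt0).
case/orP: b_std => [b0|/andP [/eqP b0 /forallP bj]]; rewrite /lexstd.
  by rewrite (leq_ltn_trans ab0).
rewrite b0 leq_eqVlt in ab0; case/orP: ab0 => [->|->] //=.
rewrite orbC; apply/orP; left; apply/forallP => j; apply/implyP => js.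
have := bj j; rewrite js /= => /eqP bj0.
by rewrite -leqn0 -bj0 ab // neq_max //; case/andP: js.
Qed.

(** The lex ideal is generated in degree [p]. *)
Lemma size_std_low i : (i < p)%N -> size (std lexstd i) = numN n.+1 i.
Proof.
move=> ip; rewrite -size_monos //; congr size; apply/all_filterP/allP => m.
rewrite mem_monos => /eqP mi; rewrite /lexstd.
have m0 : (m ord0 <= i)%N by rewrite -mi mdegE (bigD1 ord0) //= leq_addr.
have [//|ge] := ltnP (m ord0) p.-1; have m0E : m ord0 = p.-1 by lia.
rewrite m0E eqxx /=; apply/forallP => j; apply/implyP => /andP [j0 _].
have : (m ord0 + m j <= i)%N.
  rewrite -mi mdegE (bigD1 ord0) //= (bigD1 j) /= ?leq_add2l ?leq_addr //.
  by rewrite -val_eqE /= -lt0n.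
by rewrite -leqn0; lia.
Qed.

Lemma card_geq_ord (j : nat) : #|[set i : 'I_n.+1 | (j <= i)%N]| = (n.+1 - j)%N.
Proof.
rewrite -sum1dep_card -(big_geq_mkord j n.+1 predT (fun=> 1%N)).
by rewrite sum_nat_const_nat muln1.
Qed.

Definition lexnstd d := [seq m : 'X_{1..n.+1} <- monos n.+1 d | ~~ lexstd m].

Lemma size_std_nstd d : (size (std lexstd d) + size (lexnstd d))%N = numN n.+1 d.
Proof. by rewrite !size_filter count_predC size_monos. Qed.

(** Every monomial of the lex ideal is some generator [g l] times a monomial in the variables from
    index [l] on; the sum counts these pairs. *)
Lemma size_lexnstd_leq a :
  (size (lexnstd (p + a)) <= \sum_(l < s) numN (n.+1 - l) a)%N.
Proof.
have sn1 : (s <= n.+1)%N by rewrite ltnW.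
pose g (l : 'I_s) : 'X_{1..n.+1} := (U_(ord0) *+ p.-1 + U_(widen_ord sn1 l))%MM.
pose T := [seq (u + g l)%MM | l <- enum 'I_s,
  u <- monos_on [set i : 'I_n.+1 | (l <= i)%N] a].
have -> : (\sum_(l < s) numN (n.+1 - l) a)%N = size T.
  rewrite size_allpairs_dep sumnE big_map big_enum /=; apply: eq_bigr => l _.
  by rewrite size_monos_on ?card_geq_ord // subn_gt0 (leq_trans (ltn_ord l)).
apply: uniq_leq_size; first by rewrite filter_uniq ?monos_uniq.
move=> m; rewrite mem_filter mem_monos negb_or -leqNgt => /andP [/andP [m0 mN] /eqP md].
(* [l] is 0 when the first exponent is at least [p], and otherwise the least positive index with
   nonzero exponent. *)
have [l gm lm] : exists2 l : 'I_s, (g l <= m)%MM &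
    forall i : 'I_n.+1, (i < l)%N -> m i = g l i.
  have g0E (l : 'I_s) : g l ord0 = (p.-1 + (val l == 0%N))%N.
    by rewrite mnmDE mulmnE !mnm1E eqxx mul1n -val_eqE.
  have giE (l : 'I_s) (i : 'I_n.+1) : i != ord0 -> g l i = (val l == i) :> nat.
    move=> i0; rewrite mnmDE mulmnE !mnm1E [ord0 == i]eq_sym (negPf i0) mul0n add0n.
    by rewrite -val_eqE.
  have [lt|ge] := ltnP p.-1 (m ord0).
    exists (Ordinal s_gt0) => //.
    apply/mnm_lepP => i; case: (eqVneq i ord0) => [->|i0]; first by rewrite g0E /= addn1.
    by rewrite giE //= eq_sym -[_ == _]/(i == ord0) (negPf i0).
  have m0E : m ord0 = p.-1 by apply/eqP; rewrite eqn_leq ge m0.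
  move: mN; rewrite m0E eqxx /= => /forallPn [j0]; rewrite negb_imply => j0P.
  case: (@arg_minnP _ j0 (fun j : 'I_n.+1 => (0 < j < s)%N && (m j != 0%N)) val j0P).
  move=> j /andP [/andP [j_gt0 js] mj] jmin.
  exists (Ordinal js) => [|i /= ij].
    apply/mnm_lepP => i; case: (eqVneq i ord0) => [->|i0].
      by rewrite g0E m0E /= (gtn_eqF j_gt0) addn0.
    by rewrite giE //= ; case: eqP => // ji; rewrite lt0n; have -> : i = j by exact: val_inj.
  case: (eqVneq i ord0) => [->|i0]; first by rewrite g0E m0E /= (gtn_eqF j_gt0) addn0.
  rewrite giE //= (gtn_eqF ij); apply/eqP; apply: contraTT ij => mi.
  rewrite -leqNgt; have [lt|si] := ltnP i s; last exact: leq_trans (ltnW js) si.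
  by apply: jmin; rewrite mi lt !andbT lt0n -[_ != _]/(i != ord0).
apply/allpairsPdep; exists l, (m - g l)%MM; split; rewrite ?mem_enum ?submK //.
rewrite mem_monos_on; apply/andP; split.
  have := congr1 (@mdeg _) (submK gm); rewrite !mdegD mdegMn !mdeg1 md mul1n => e.
  by apply/eqP; lia.
apply/forallP => i; rewrite inE; apply/implyP; rewrite mnmBE leqNgt.
by apply: contraNN => /lm ->; rewrite subnn.
Qed.

Lemma size_std_geq i : (growth_bound n.+1 p s i <= size (std lexstd i))%N.
Proof.
rewrite /growth_bound; case: ltnP => [/size_std_low -> //|pi].
have := size_lexnstd_leq (i - p); rewrite subnKC //.
by have := size_std_nstd i; lia.
Qed.

(** The [s] generators of the lex ideal are themselves distinct nonstandard monomials. *)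
Lemma size_lexnstd_geq : (s <= size (lexnstd p))%N.
Proof.
have sn1 : (s <= n.+1)%N by rewrite ltnW.
pose g (l : 'I_s) : 'X_{1..n.+1} := (U_(ord0) *+ p.-1 + U_(widen_ord sn1 l))%MM.
have g_inj : injective g.
  move=> l l' /addmI /mnmP /(_ (widen_ord sn1 l)); rewrite !mnm1E eqxx.
  by case: eqP => // /(congr1 val) /= ll _; apply: val_inj.
rewrite -{1}(card_ord s) cardE -(size_map g); apply: uniq_leq_size.
  by rewrite map_inj_uniq ?enum_uniq.
move=> _ /mapP [l _ ->]; rewrite mem_filter mem_monos mdegD mdegMn !mdeg1.
rewrite mul1n addn1 prednK // eqxx andbT negb_or -leqNgt.
rewrite mnmDE mulmnE !mnm1E eqxx mul1n leq_addr /=.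
rewrite negb_and -implybE; apply/implyP => l0; apply/forallPn; exists (widen_ord sn1 l).
rewrite negb_imply /= ltn_ord andbT mnmDE mulmnE !mnm1E eqxx addn_eq0 andbF andbT.
by move: l0; rewrite -val_eqE /= -{2}[p.-1]addn0 eqn_add2l; case: (val l).
Qed.

End LexStandard.

(** * Iterated Pascal identities and the binomial expansion of [numN r p - s] *)

Lemma numN_hockey_degree (q a p : nat) : (0 < q)%N -> (0 < p)%N ->
  numN q.+1 (p + a) =
    (\sum_(t < p.-1) numN q (p - t + a) + numN q.+1 a.+1)%N.
Proof.
move=> q0; case: p => // p _ /=; elim: p => [|p IHp]; first by rewrite big_ord0 add1n.
by rewrite big_ord_recl subn0 -addnA -IHp -numNS // addSn.
Qed.

Lemma numN_hockey_vars (r s a : nat) : (s < r)%N ->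
  numN r a.+1 = (numN (r - s) a.+1 + \sum_(l < s) numN (r - l) a)%N.
Proof.
elim: s => [|s IHs] sr; first by rewrite big_ord0 subn0 addn0.
rewrite (IHs (ltnW sr)) big_ord_recr /= addnA addnAC; congr addn.
have -> : (r - s)%N = (r - s.+1).+1 by lia.
by rewrite numNS //; lia.
Qed.

Section Expansion.
Variables (r p s : nat).
Hypotheses (p_gt0 : (0 < p)%N) (s_gt0 : (0 < s)%N) (sr : (s < r)%N).

(** Read off from [numN r p = \sum_(t < p.-1) numN r.-1 (p - t) + r]: the tops of these binomials,
    then [r - s] as top of a last binomial over 1. *)
Definition expansion_tops : seq nat := rcons [seq r.-2 + p - t | t <- iota 0 p.-1]%N (r - s)%N.

Lemma size_expansion_tops : size expansion_tops = p.
Proof. by rewrite size_rcons size_map size_iota prednK. Qed.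

Lemma nth_expansion_tops t : (t < p.-1)%N -> nth 0%N expansion_tops t = (r.-2 + p - t)%N.
Proof.
move=> tp; rewrite nth_rcons size_map size_iota tp (nth_map 0%N) ?size_iota //.
by rewrite nth_iota.
Qed.

Lemma last_expansion_tops : nth 0%N expansion_tops p.-1 = (r - s)%N.
Proof. by rewrite nth_rcons size_map size_iota ltnn eqxx. Qed.

(** When [numN r (p + a)] is expanded by [numN_hockey_degree], the subtracted sum only meets the
    last term and leaves [numN (r - s) a.+1] by [numN_hockey_vars]. *)
Lemma shifted_expansion_growth a :
  shifted_expansion expansion_tops p a = growth_bound r p s (p + a).
Proof.
have r2 : r = r.-1.+1 by lia.
rewrite /shifted_expansion /growth_bound size_expansion_tops ltnNge leq_addr /= addKn.
have rE := @numN_hockey_degree r.-1 a p; rewrite -r2 in rE.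
rewrite rE; [|lia|lia]; rewrite (numN_hockey_vars a sr) addnA addnK.
have -> : p = p.-1.+1 by lia.
rewrite big_ord_recr /=; congr addn.
  apply: eq_bigr => t _; have tp := ltn_ord t; rewrite nth_expansion_tops // /numN.
  by congr binomial; lia.
by rewrite last_expansion_tops /numN; congr binomial; lia.
Qed.

Lemma binomial_expansion_tops :
  binomial_expansion (numN r p - s) p expansion_tops.
Proof.
split.
- by rewrite size_expansion_tops p_gt0 leqnn.
- apply/(sortedP 0%N) => t; rewrite size_expansion_tops => tp.
  rewrite (@nth_expansion_tops t); last by lia.
  have [lt|ge] := ltnP t.+1 p.-1; first by rewrite nth_expansion_tops //=; lia.
  have -> : t.+1 = p.-1 by lia.
  by rewrite last_expansion_tops /=; lia.
- by rewrite size_expansion_tops /expansion_tops last_rcons; lia.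
have := shifted_expansion_growth 0.
rewrite /growth_bound addn0 ltnn subnn.
under [X in (_ = _ - X)%N]eq_bigr do rewrite numN0.
rewrite sum1_card card_ord => <-.
by apply: eq_bigr => t _; rewrite !addn0.
Qed.

End Expansion.

(** * Two socle degrees *)

Lemma sum_generators (e : nat) (t : e.+1.-tuple nat) (F : nat -> nat) :
  (\sum_(l : generators t) F (gendeg l) = \sum_(j < e.+1) nth 0%N t j * F j)%N.
Proof.
transitivity (\sum_(j < e.+1) \sum_(y < nth 0%N t j) F j)%N.
  by rewrite sig_big_dep; apply: eq_bigl.
by apply: eq_bigr => j _; rewrite sum_nat_const card_ord.
Qed.

Lemma size_cols_generators (r e : nat) (t : e.+1.-tuple nat) (i : nat) : (0 < r)%N ->
  size (cols r (@gendeg e t) i) = (\sum_(i <= j < e.+1) numN r (j - i) * nth 0%N t j)%N.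
Proof.
move=> r0; rewrite size_cols //.
rewrite (sum_generators t (fun d => if (i <= d)%N then numN r (d - i) else 0%N)).
rewrite (big_geq_mkord i e.+1 predT (fun j => numN r (j - i) * nth 0%N t j)%N).
rewrite [RHS]big_mkcond; apply: eq_bigr => j _ /=.
by case: ifP; rewrite ?muln0 // mulnC.
Qed.

Lemma card_generators (e : nat) (t : e.+1.-tuple nat) (i : nat) : (i <= e)%N ->
  #|[pred l : generators t | gendeg l == i]| = nth 0%N t i.
Proof.
move=> ie; rewrite -sum1_card big_mkcond /=.
rewrite (sum_generators t (fun d => if d == i then 1%N else 0%N)).
rewrite (bigD1 (Ordinal (ie : (i < e.+1)%N))) //= eqxx muln1 big1 ?addn0 // => j ji.
by rewrite -[_ == _]/(j == Ordinal (ie : (i < e.+1)%N)) (negPf ji) muln0.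
Qed.

Section InverseSystemRanks.
Variables (k : fieldType) (r e : nat) (t : e.+1.-tuple nat).
Local Notation dg := (@gendeg e t).
Implicit Types (c : generators t -> 'X_{1..r} -> k).

Lemma rank_catmx_eq_gt c i : nth 0%N t i = 0%N ->
  \rank (catmx dg c i) = \rank (catmx_gt dg c i).
Proof.
move=> ti; apply: rank_colmx_mem => lm; rewrite mem_cols_gt mem_cols.
rewrite andbC; apply/esym/andb_idr => /eqP ilm; rewrite ltn_neqAle -{2}ilm leq_addr andbT.
apply/eqP => il; have : (0 < nth 0%N t (dg lm.1))%N.
  exact: leq_ltn_trans (leq0n _) (ltn_ord (tagged lm.1)).
by rewrite -il ti.
Qed.

Lemma rank_catmx_gt_top c : \rank (catmx_gt dg c e) = 0%N.
Proof.
apply/eqP; rewrite -leqn0 (leq_trans (rank_leq_col _)) // leqn0 size_eq0.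
rewrite -(negbK (_ == _)) -has_filter; apply/hasPn => lm _.
by rewrite -leqNgt gendeg_leq.
Qed.

(** Only the generators of degree [i] themselves, contracted by 1, are missing from [catmx_gt]. *)
Lemma rank_catmx_leq_gt c i : (i <= e)%N ->
  (\rank (catmx dg c i) <= \rank (catmx_gt dg c i) + nth 0%N t i)%N.
Proof.
move=> ie; pose T := [seq (l, 0%MM : 'X_{1..r}) | l <- enum [pred l | dg l == i]].
have -> : nth 0%N t i = size T by rewrite size_map -cardE card_generators.
apply: (@leq_trans (\rank (catmx_gt dg c i) + \rank (colmx c i T))); last first.
  by rewrite leq_add2l rank_leq_col.
have sub : (kermx (catmx_gt dg c i) :&: kermx (colmx c i T) <= kermx (catmx dg c i))%MS.
  apply/sub_kermxP/row_matrixP => x; rewrite row_mul row0.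
  have := row_sub x (kermx (catmx_gt dg c i) :&: kermx (colmx c i T))%MS.
  set v := row x _ => vs.
  have /sub_kermxP /mul_colmx_eq0 v1 := submx_trans vs (capmxSl _ _).
  have /sub_kermxP /mul_colmx_eq0 v2 := submx_trans vs (capmxSr _ _).
  apply/mul_colmx_eq0 => -[l m]; rewrite mem_cols => ilm.
  have [lt|ge] := ltnP i (dg l); first by apply: v1; rewrite mem_cols_gt lt.
  apply: v2; have m0 : m == 0%MM by rewrite -mdeg_eq0; move: ilm ge => /= /eqP; lia.
  apply/mapP; exists l; last by rewrite (eqP m0).
  by rewrite mem_enum inE -(eqP ilm) /= (eqP m0) mdeg0 addn0.
have := mxrankS sub.
have := mxrank_sum_cap (kermx (catmx_gt dg c i)) (kermx (colmx c i T)).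
have := rank_leq_col (kermx (catmx_gt dg c i) + kermx (colmx c i T))%MS.
rewrite !mxrank_ker.
have := rank_leq_row (catmx dg c i); have := rank_leq_row (catmx_gt dg c i).
by have := rank_leq_row (colmx c i T); lia.
Qed.

Lemma inverse_system_ranks (I : idealr {mpoly k[r]}) (h : e.+1.-tuple nat) :
  has_data I t -> hvector I h ->
  exists c, forall i, (i <= e)%N ->
    nth 0%N h i = \rank (catmx dg c i) /\
    nth 0%N t i = (\rank (catmx dg c i) - \rank (catmx_gt dg c i))%N.
Proof.
move=> I_data I_h; have [c cI] := exists_inverse_system I_data I_h.
exists c => i ie; split.
  exact: has_dim_unique (I_h i ie) (has_dim_component (cI i)).
rewrite -rank_kermx_gt_catmx; apply: has_dim_unique (I_data.2 i ie) _.
apply: has_dim_socle (cI i) => v.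
apply: iff_trans (iff_sym (rwP sub_kermxP)) _.
apply: iff_trans (mul_catmx_gt_eq0 _ _ _) _.
have XE j : annihilator dg c (rpoly v * 'X_j) <-> rpoly v * 'X_j \in I.
  have vj : rpoly v * 'X_j \is i.+1.-homog.
    by rewrite -addn1 dhomogM ?rpoly_homog // dhomogX /= mdeg1.
  rewrite -(prowK vj); apply: iff_trans (annihilator_homog _ _ _) _.
  exact: iff_sym (cI _ _).
by split=> vX j; apply/XE.
Qed.

End InverseSystemRanks.

(** * Upper bound and constructions for socle in degrees [p] and [e] *)

Section TwoSocleDegrees.
Variables (k : fieldType) (n e p : nat) (t : e.+1.-tuple nat).
Local Notation r := n.+1.
Local Notation s := (nth 0%N t p).
Local Notation dg := (@gendeg e t).
Hypotheses (n_gt0 : (0 < n)%N) (p_gt0 : (0 < p)%N) (pe : (p < e)%N)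
  (t_e : nth 0%N t e = 1%N) (s_gt0 : (0 < s)%N) (sn : (s <= n)%N)
  (t_0 : forall i, (i <= e)%N -> i <> p -> i <> e -> nth 0%N t i = 0%N).
Implicit Types (c : generators t -> 'X_{1..r} -> k).

Lemma exists_top_generator :
  exists2 l0 : generators t, dg l0 = e & forall l, (p < dg l)%N -> l = l0.
Proof.
have y0 : (0 < nth 0%N t (@ord_max e))%N by rewrite t_e.
exists (Tagged (fun i : 'I_e.+1 => 'I_(nth 0%N t i)) (Ordinal y0)) => // -[i y].
rewrite /gendeg /= => pi; have ie : i = ord_max.
  apply/val_inj/eqP => /=; apply: contraTT (leq_ltn_trans (leq0n _) (ltn_ord y)).
  by move=> /eqP i_e; rewrite t_0 // ?leq_ord //; lia.
subst i; congr Tagged; apply: val_inj => /=.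
by have := leq_trans (ltn_ord y) (eq_leq t_e); rewrite ltnS leqn0 => /eqP.
Qed.

Lemma size_cols_two i : (i <= e)%N ->
  size (cols r dg i) = (numN r (e - i) + if (i <= p)%N then s * numN r (p - i) else 0)%N.
Proof.
move=> ie; rewrite size_cols_generators // big_nat_recr //= t_e muln1 addnC.
congr addn; case: leqP => [ip|pi].
  rewrite (big_cat_nat ip (ltnW pe)) /= big_nat big1 ?add0n => [|j /andP [_ jp]].
    rewrite big_ltn // big_nat big1 => [|j /andP [pj je]]; first by rewrite addn0 mulnC.
    by rewrite t_0 ?muln0 //; lia.
  by rewrite t_0 ?muln0 //; lia.
rewrite big_nat big1 // => j /andP [ij je].
by rewrite t_0 ?muln0 //; lia.
Qed.

Lemma mul_colmx_hankel c l0 T i (v : 'rV_(size (monos r i))) : (i <= e)%N ->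
  (forall lm, lm \in T <-> lm.1 = l0 /\ (i + mdeg lm.2)%N = e) ->
  v *m colmx c i T = 0 <-> v *m hankel (c l0) i (e - i) = 0.
Proof.
move=> ie TE; rewrite mul_colmx_eq0 mul_hankel_eq0 subnKC //; split=> [v0 m me|v0 [l m]].
  rewrite act_rpoly ?me ?subnKC //; apply: (v0 (l0, m)); apply/TE.
  by rewrite /= me subnKC.
move=> /TE [/= -> im]; rewrite -(@act_rpoly _ _ e) // v0 //; lia.
Qed.

(** Above degree [p] only the top generator contributes columns. *)
Lemma rank_catmx_hankel c l0 i : dg l0 = e -> (forall l, (p < dg l)%N -> l = l0) ->
  (p < i <= e)%N -> \rank (catmx dg c i) = \rank (hankel (c l0) i (e - i)).
Proof.
move=> l0e l0_uniq /andP [pi ie]; apply: eq_ker_rank => v.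
apply: mul_colmx_hankel => // -[l m]; rewrite mem_cols /=.
split=> [/eqP ilm|[-> ->]]; last by rewrite l0e.
have ll0 : l = l0 by apply: l0_uniq; lia.
by rewrite ilm ll0.
Qed.

Lemma mul_catmx_gt_hankel c l0 (v : 'rV_(size (monos r p))) :
  dg l0 = e -> (forall l, (p < dg l)%N -> l = l0) ->
  v *m catmx_gt dg c p = 0 <-> v *m hankel (c l0) p (e - p) = 0.
Proof.
move=> l0e l0_uniq.
apply: mul_colmx_hankel => [|[l m]]; first exact: ltnW.
rewrite mem_cols_gt /=; split=> [/andP [/l0_uniq -> /eqP]|[-> ->]]; rewrite l0e //.
by rewrite pe eqxx.
Qed.

Lemma rank_catmx_gt_hankel c l0 : dg l0 = e -> (forall l, (p < dg l)%N -> l = l0) ->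
  \rank (catmx_gt dg c p) = \rank (hankel (c l0) p (e - p)).
Proof. by move=> l0e l0_uniq; apply: eq_ker_rank => v; apply: mul_catmx_gt_hankel. Qed.

Lemma has_data_of_ranks c :
  \rank (catmx dg c e) = 1%N ->
  \rank (catmx dg c p) = (\rank (catmx_gt dg c p) + s)%N ->
  \rank (catmx dg c 1) = size (monos r 1) ->
  exists I : idealr {mpoly k[r]}, has_data I t /\
    forall i, has_dim (@component k r I i) (\rank (catmx dg c i)).
Proof.
move=> rk_e rk_p rk_1; apply: annihilator_data => //.
- exact: gendeg_leq.
- move=> i ie; have [->//|ip] := eqVneq i p.
  have [->|i_e] := eqVneq i e; first by rewrite rk_e t_e rank_catmx_gt_top.
  have ti : nth 0%N t i = 0%N by apply: t_0 => //; apply/eqP.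
  by rewrite ti addn0 rank_catmx_eq_gt.
by rewrite t_e.
Qed.

(** The maximum to be attained. The index [minn i (e - i)] reflects the symmetry of Hankel ranks
    above degree [p]; at [2 * p = e] both branches agree by [gencompressed_h_high]. *)
Definition gencompressed_h (i : nat) : nat :=
  if (2 * p <= e)%N then
    if (i <= p)%N then numN r i else growth_bound r p s (minn i (e - i))
  else minn (numN r i) (size (cols r dg i)).

Lemma hvector_leq (I : idealr {mpoly k[r]}) (h : e.+1.-tuple nat) :
  has_data I t -> hvector I h ->
  forall i, (i <= e)%N -> (nth 0%N h i <= gencompressed_h i)%N.
Proof.
move=> I_data I_h i ie; have [c cI] := inverse_system_ranks I_data I_h.
have rk_row : (nth 0%N h i <= numN r i)%N.
  by rewrite (cI i ie).1 -size_monos ?rank_leq_row.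
rewrite /gencompressed_h; case: (leqP (2 * p) e) => [ep|_]; last first.
  by rewrite leq_min rk_row (cI i ie).1 rank_leq_col.
case: (leqP i p) => [//|pi].
have [l0 l0e l0_uniq] := exists_top_generator.
(* Symmetry of the Hankel ranks brings the degree down to at most [e / 2]. *)
have -> : nth 0%N h i = \rank (hankel (c l0) (minn i (e - i)) (e - minn i (e - i))).
  rewrite (cI i ie).1 (@rank_catmx_hankel _ l0) ?pi //.
  have [le|lt] := leqP i (e - i); first by [].
  by rewrite subKn // rank_hankelC.
set j := minn i (e - i); rewrite /growth_bound; case: (ltnP j p) => [_|pj].
  by rewrite -size_monos ?rank_leq_row.
have jE : j = (p + (j - p))%N by rewrite subnKC.
have sr : (s <= r)%N by lia.
have := @rank_hankel_growth _ r (c l0) p (j - p) (e - j) s sr.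
have -> : (j - p + (e - j) = e - p)%N by rewrite /j; lia.
rewrite -(@rank_catmx_gt_hankel c l0) // -jE.
(* The socle in degree [p] makes the Hankel matrix of the top functional fall short of full row rank
   by at least [s]. *)
move=> H; have /H : (\rank (catmx_gt dg c p) + s <= size (monos r p))%N.
  have := (cI p (ltnW pe)).2; have := rank_leq_row (catmx dg c p); lia.
by have := size_monos j (ltn0Sn n); lia.
Qed.

Lemma exists_compressed_high (char0 : [pchar k] =i pred0) : (e < 2 * p)%N ->
  exists I : idealr {mpoly k[r]}, has_data I t /\
    forall i, (i <= e)%N -> has_dim (@component k r I i) (gencompressed_h i).
Proof.
move=> ep; have [c cP] := @exists_generic k r (generators t) dg char0 e.
have cE i : (i <= e)%N -> \rank (catmx dg c i) = gencompressed_h i.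
  by move=> ie; rewrite cP // /gencompressed_h leqNgt ep size_monos.
have [l0 l0e l0_uniq] := exists_top_generator.
have [||| I [I_data I_dim]] := @has_data_of_ranks c.
- rewrite cP // size_monos // size_cols_two // leqNgt pe subnn numN0 addn0.
  by have := numN_gt0 r e; lia.
- have rkp := cP p (ltnW pe); have := rank_catmx_leq_gt c (ltnW pe).
  rewrite (@rank_catmx_gt_hankel c l0) //.
  have := rank_leq_col (hankel (c l0) p (e - p)).
  have p1 : p = p.-1.+1 by lia.
  (* Room for the [s] generators of degree [p]: Pascal's rule with [e - p <= p - 1] and
     [s <= n = numN n 1]. *)
  have Np : (numN r (e - p) + s <= numN r p)%N.
    rewrite [in X in (_ <= X)%N]p1 numNS // -p1 addnC leq_add //.
      by rewrite (leq_trans sn) // -{1}(numN1 n_gt0) leq_numN.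
    by apply: leq_numN; lia.
  have := size_cols_two (ltnW pe); rewrite leqnn subnn numN0 muln1.
  by have := size_monos (e - p) (ltn0Sn n); have := size_monos p (ltn0Sn n); lia.
- rewrite cP ?size_monos ?size_cols_two //; try lia.
  have : (numN r 1 <= numN r (e - 1))%N by apply: leq_numN; lia.
  lia.
by exists I; split=> // i ie; rewrite -cE.
Qed.

(* The degree-p generators are dual to the kernel of the Hankel matrix of the
   degree-e one, so that together they leave no form of degree p. *)
Lemma exists_completion (F : 'X_{1..r} -> k) :
  (\rank (hankel F p (e - p)) + s)%N = size (monos r p) ->
  exists c, (forall l, dg l = e -> c l = F) /\ \rank (catmx dg c p) = size (monos r p).
Proof.
set H := hankel F p (e - p) => rkH.
set U := row_base (kermx H).
have U_s : \rank (kermx H) = s by rewrite mxrank_ker; lia.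
pose D := pinvmx U.
pose G (j : nat) (m : 'X_{1..r}) : k :=
  \sum_x \sum_(y | val y == j) D x y *+ (mon x == m).
pose c (l : generators t) := if dg l == e then F else G (tagged l).
exists c; split=> [l le|]; first by rewrite /c le eqxx.
have [l0 l0e l0_uniq] := exists_top_generator.
suff : row_free (catmx dg c p) by move/eqP.
apply/inj_row_free => v /mul_catmx_eq0 v0.
have vH : v *m H = 0.
  apply/mul_hankel_eq0 => m me; have pm : (p + mdeg m)%N = dg l0 by rewrite me l0e; lia.
  by have := v0 l0 m pm; rewrite /c l0e eqxx subnKC // ltnW.
have /submxP [w vE] : (v <= U)%MS by rewrite eq_row_base; apply/sub_kermxP.
have wE : w = v *m D by rewrite vE -mulmxA mulmxVp ?row_base_free ?mulmx1.
rewrite vE; suff -> : w = 0 by rewrite mul0mx.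
apply/rowP => y; rewrite [RHS]mxE.
have ys : (y < nth 0%N t (Ordinal (ltnW pe : p < e.+1)%N))%N.
  by rewrite /= -[X in (_ < X)%N]U_s.
have /= := v0 (Tagged (fun i : 'I_e.+1 => 'I_(nth 0%N t i)) (Ordinal ys)) 0%MM.
rewrite mdeg0 addn0 /c /gendeg /= (ltn_eqF pe) => /(_ erefl).
rewrite act_rpoly ?mdeg0 ?addn0 // => <-; rewrite wE mxE; apply: eq_bigr => x _.
congr (_ * _); rewrite addm0 /G (bigD1 x) //= eqxx [X in _ + X]big1 ?addr0 => [|x' x'x].
  rewrite (bigD1 y) //= big1 ?addr0 // => y' /andP [/eqP yy] /eqP; case.
  exact: val_inj.
by rewrite big1 // => y' _; rewrite (inj_eq (@mon_inj r p)) (negPf x'x).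
Qed.

Lemma exists_compressed_low (char0 : [pchar k] =i pred0) : (2 * p <= e)%N ->
  exists I : idealr {mpoly k[r]}, exists2 h : nat -> nat, has_data I t /\
    (forall i, (i <= e)%N -> has_dim (@component k r I i) (h i)) &
    forall i, (i <= e)%N -> (gencompressed_h i <= h i)%N.
Proof.
(* Taking the points in degree [e./2] places it between [i] and [e - i] for all [i <= e / 2], as
   [rank_hankel_powersum] requires. *)
move=> ep; pose d := e./2.
pose P := @lexstd n p s.
have P_down := @lexstd_down n p s sn s_gt0.
pose F := @powersum k n P d.
have rkF i j : (i <= d <= j)%N -> \rank (hankel F i j) = size (std P i).
  exact: (rank_hankel_powersum char0 P_down).
have pd : (p <= d <= e - p)%N by rewrite /d; lia.
(* Exactly [s] monomials of degree [p] are nonstandard, so the Hankel matrix of [F] misses full row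
   rank there by exactly [s]. *)
have std_p : (size (std P p) + s)%N = size (monos r p).
  have := size_lexnstd_geq p_gt0 sn; have := size_lexnstd_leq p_gt0 sn s_gt0 0.
  have := size_std_nstd n p s p; rewrite size_monos // addn0 -/P.
  under [X in (_ <= X)%N]eq_bigr do rewrite numN0.
  by rewrite sum1_card card_ord; lia.
have [|c [cF rk_p]] := @exists_completion F; first by rewrite rkF.
have [l0 l0e l0_uniq] := exists_top_generator.
have c0 := cF _ l0e.
(* Below degree [p] all monomials are standard, so the columns of [F] alone give full row rank. *)
have rk_low i : (i < p)%N -> \rank (catmx dg c i) = size (monos r i).
  move=> ip; suff : row_free (catmx dg c i) by move/eqP.
  have : row_free (hankel F i (e - i)).
    by rewrite /row_free rkF ?size_std_low ?size_monos // /d; lia.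
  move=> F_free; apply/inj_row_free => v /mul_catmx_eq0 v0.
  apply/eqP; rewrite -(mulmx_free_eq0 v F_free); apply/eqP/mul_hankel_eq0 => m me.
  have im : (i + mdeg m)%N = dg l0 by rewrite me l0e; lia.
  by have := v0 l0 m im; rewrite l0e c0 subnKC //; lia.
have rk_high i : (p < i <= e)%N -> \rank (catmx dg c i) = size (std P (minn i (e - i))).
  move=> pi; rewrite (@rank_catmx_hankel _ l0) // c0.
  have [le|lt] := leqP i (e - i); first by rewrite rkF // /d; lia.
  by rewrite rank_hankelC rkF // /d; lia.
have [||| I [I_data I_dim]] := @has_data_of_ranks c.
- by rewrite rk_high ?pe ?leqnn // subnn minn0 size_std_low // numN0.
- by rewrite rk_p (@rank_catmx_gt_hankel _ l0) // c0 rkF // std_p.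
- by have [lt|ge] := ltnP 1 p; [rewrite rk_low | have -> : 1%N = p by lia].
exists I, (fun i => \rank (catmx dg c i)) => // i ie.
rewrite /gencompressed_h ep; case: (ltngtP i p) => [ip|pi|->].
- by rewrite rk_low // size_monos.
- by rewrite rk_high ?pi //; apply: size_std_geq.
by rewrite rk_p size_monos.
Qed.

End TwoSocleDegrees.

(** The sum subtracted in [rnum] counts the columns of the catalecticant matrix, so the difference
    is the column bound. *)
Lemma rnum_generators (r e : nat) (t : e.+1.-tuple nat) (i : nat) : (0 < r)%N ->
  (numN r i)%:Z - rnum r t i = (size (cols r (@gendeg e t) i))%:Z.
Proof.
move=> r0; rewrite size_cols_generators // /rnum opprB addrC subrK.
by rewrite (big_morph Posz PoszD (erefl 0%:Z)).
Qed.

Lemma growth_bound_socle (r p s : nat) : growth_bound r p s p = (numN r p - s)%N.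
Proof.
rewrite /growth_bound ltnn subnn; congr subn.
by under eq_bigr do rewrite numN0; rewrite sum1_card card_ord.
Qed.

(** * Existence and uniqueness of the maximal h-vector *)

Section Maximum.
Variables (k : fieldType) (n e p : nat) (t : e.+1.-tuple nat).
Local Notation r := n.+1.
Local Notation s := (nth 0%N t p).
Hypotheses (char0 : [pchar k] =i pred0).
Hypotheses (n_gt0 : (0 < n)%N) (p_gt0 : (0 < p)%N) (pe : (p < e)%N)
  (t_e : nth 0%N t e = 1%N) (s_gt0 : (0 < s)%N) (sn : (s <= n)%N)
  (t_0 : forall i, (i <= e)%N -> i <> p -> i <> e -> nth 0%N t i = 0%N).

(** On the boundary [2 * p = e], there are no more rows than columns up to degree [p], and no more
    columns than rows beyond it. *)
Lemma gencompressed_h_high : (e <= 2 * p)%N -> forall i, (i <= e)%N ->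
  gencompressed_h n p t i = minn (numN r i) (size (cols r (@gendeg e t) i)).
Proof.
move=> ep i ie; rewrite /gencompressed_h; case: leqP => // pe2.
rewrite (size_cols_two n_gt0 p_gt0 pe t_e s_gt0 sn t_0) //; case: leqP => ip.
  have := @leq_numN r i (e - i); rewrite (_ : (i <= e - i)%N); last by lia.
  by move=> /(_ isT) le; apply/esym/minn_idPl; lia.
have lt : (minn i (e - i) < p)%N by lia.
rewrite /growth_bound lt addn0; have -> : minn i (e - i) = (e - i)%N by lia.
by apply/esym/minn_idPr/leq_numN; lia.
Qed.

(** The constructions give h-vectors at least [gencompressed_h], and [hvector_leq] gives the reverse
    inequality. *)
Lemma exists_max_admissible : exists I : idealr {mpoly k[r]}, exists h : e.+1.-tuple nat,
  [/\ has_data I t, hvector I h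
    & forall i, (i <= e)%N -> nth 0%N h i = gencompressed_h n p t i].
Proof.
have [I [h [I_data I_dim] h_ge]] : exists I : idealr {mpoly k[r]},
    exists2 h : nat -> nat, has_data I t /\
      (forall i, (i <= e)%N -> has_dim (@component k r I i) (h i)) &
      forall i, (i <= e)%N -> (gencompressed_h n p t i <= h i)%N.
  have [ep|ep] := leqP (2 * p) e; first exact: exists_compressed_low.
  have [I [I_data I_dim]] :=
    exists_compressed_high n_gt0 p_gt0 pe t_e s_gt0 sn t_0 char0 ep.
  by exists I, (gencompressed_h n p t).
have hE i : (i <= e)%N -> nth 0%N [tuple h i | i < e.+1] i = h i.
  by move=> ie; rewrite -[i]/(val (Ordinal (ie : (i < e.+1)%N))) -tnth_nth tnth_mktuple.
have I_h : hvector I [tuple h i | i < e.+1].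
  by move=> i ie; rewrite hE //; apply: I_dim.
exists I, [tuple h i | i < e.+1]; split => // i ie.
apply/eqP; rewrite eqn_leq (hvector_leq n_gt0 p_gt0 pe t_e s_gt0 sn t_0 I_data I_h) //.
by rewrite hE // h_ge.
Qed.

Lemma exists_generalized_compressed :
  exists I : idealr {mpoly k[r]}, generalized_compressed I t.
Proof.
have [I [h [I_data I_h hE]]] := exists_max_admissible.
exists I; split => //; exists h => //; split; first by exists I.
move=> h' [I' I'_data I'_h] i ie; rewrite hE //.
exact: (hvector_leq n_gt0 p_gt0 pe t_e s_gt0 sn t_0 I'_data I'_h).
Qed.

(** A maximum dominates the constructed h-vector and is bounded by [hvector_leq]. *)
Lemma generalized_compressedE (I : idealr {mpoly k[r]}) (h : e.+1.-tuple nat) :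
  generalized_compressed I t -> hvector I h ->
  forall i, (i <= e)%N -> nth 0%N h i = gencompressed_h n p t i.
Proof.
move=> [I_data [h' [_ h'_max] I_h']] I_h i ie.
rewrite (has_dim_unique (I_h i ie) (I_h' i ie)).
apply/eqP; rewrite eqn_leq (hvector_leq n_gt0 p_gt0 pe t_e s_gt0 sn t_0 I_data I_h') //.
have [I0 [h0 [I0_data I0_h h0E]]] := exists_max_admissible.
by rewrite -h0E // h'_max //; exists I0.
Qed.

End Maximum.

Unset Implicit Arguments.

Theorem theorem3p1 (k : fieldType) (char0 : [pchar k] =i pred0)
  (r e p : nat) (r_gt1 : (1 < r)%N) (e_gt1 : (1 < e)%N) (p_bounds : (1 <= p < e)%N)
  (s : e.+1.-tuple nat)
  (s_e : nth 0%N s e = 1%N)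
  (s_p : (1 <= nth 0%N s p <= r - 1)%N)
  (s_0 : forall i, (i <= e)%N -> i <> p -> i <> e -> nth 0%N s i = 0%N)
  (m : nat) (m_min : min_emb_dim k s m) (r_ge : (m <= r)%N) :
  (exists I : idealr {mpoly k[r]}, generalized_compressed I s) /\
  (forall (I : idealr {mpoly k[r]}) (h : e.+1.-tuple nat),
    generalized_compressed I s -> hvector I h ->
    ((e <= 2 * p)%N ->
       forall i, (i <= e)%N ->
         (nth 0%N h i)%:Z
           = Num.min ((numN r i)%:Z - rnum r s i) (numN r i)%:Z) /\
    ((2 * p < e)%N ->
       [/\ (forall i, (i <= p)%N -> nth 0%N h i = numN r i),
           (forall a, (1 <= a <= e %/ 2 - p)%N ->
              exists2 c : seq nat,
                binomial_expansion (numN r p - nth 0%N s p) p c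
                & nth 0%N h (p + a) = shifted_expansion c p a),
           (forall i, (e %/ 2 < i <= e)%N -> i <> (e - p)%N ->
              nth 0%N h i = nth 0%N h (e - i)),
           nth 0%N h (e - p) = (nth 0%N h p - nth 0%N s p)%N
         & nth 0%N h (e - p) = (numN r p - nth 0%N s p)%N])).
Proof.
case: r r_gt1 s_p r_ge => [//|n] n_gt0 s_p _; rewrite ltnS in n_gt0.
have [p_gt0 pe] := andP p_bounds.
have [s_gt0 sn] := andP s_p; rewrite subn1 /= in sn.
split; first exact: (exists_generalized_compressed char0 n_gt0 p_gt0 pe s_e s_gt0 sn s_0).
move=> I h I_gc I_h.
have hE := generalized_compressedE char0 n_gt0 p_gt0 pe s_e s_gt0 sn s_0 I_gc I_h.
split=> [ep i ie|ep].
  rewrite hE // (gencompressed_h_high n_gt0 p_gt0 pe s_e s_gt0 sn s_0) // rnum_generators // minC.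
  by rewrite /Order.min ltz_nat /minn; case: ifP.
have gE i : gencompressed_h n p s i = if (i <= p)%N then numN n.+1 i
    else growth_bound n.+1 p (nth 0%N s p) (minn i (e - i)).
  by rewrite /gencompressed_h ltnW.
(* Degree [e - p] reflects to [p], where [growth_bound] loses [s], whereas degree [p] itself has the
   full value; this breaks the symmetry there. *)
have hep : nth 0%N h (e - p) = (numN n.+1 p - nth 0%N s p)%N.
  rewrite hE ?leq_subr // gE leqNgt (_ : (p < e - p)%N) /=; last by lia.
  have -> : minn (e - p) (e - (e - p)) = p by lia.
  exact: growth_bound_socle.
split=> //.
- by move=> i ip; rewrite hE ?gE ?ip // (leq_trans ip) // ltnW.
- move=> a /andP [a_gt0 ae]; rewrite divn2 in ae.
  exists (expansion_tops n.+1 p (nth 0%N s p)); first by apply: binomial_expansion_tops.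
  rewrite shifted_expansion_growth // hE; last by lia.
  rewrite gE leqNgt -{1}[p]addn0 ltn_add2l a_gt0 /=.
  by congr growth_bound; lia.
- move=> i /andP [ei ie] i_ep; rewrite divn2 in ei.
  rewrite !hE ?leq_subr // !gE subKn // minnC leqNgt (_ : (p < i)%N) /=; last by lia.
  (* If [e - i <= p], excluding [i = e - p] makes this strict, and [growth_bound] then takes its
     full value [numN]. *)
  case: leqP => // eip; rewrite /growth_bound.
  have -> : minn (e - i) i = (e - i)%N by lia.
  by rewrite (_ : (e - i < p)%N) //; lia.
by rewrite hep hE ?gE ?leqnn // ltnW.
Qed.
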